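(* Let $p\geq2$, $0\le\kappa\le1$, let $d,K\ge1$ be integers, let $\mathcal{X}\subseteq\mathbb{R}^d$ be a closed convex set with $\mathcal{X}\supseteq\mathcal{B}_p^d$, and let $\varepsilon\in(0,1/2)$, $\gamma\in(1/\mathrm{poly}(d),1)$. Then, for any local oracle, $$\mathrm{Compl}_{\mathrm{HP}}^{\gamma}\big(\mathcal{F}^{\kappa}_{\ell_p^d}(1),\mathcal{X},K,\varepsilon\big)\geq M,$$ where $M$ is (implicitly) defined by $$M:=\min\bigg\{\Big(\frac{1}{2^{3+4\kappa}\,\varepsilon\,(\min\{p,\ln(d)\})^{\kappa}}\Big)^{\frac{p}{1+\kappa(1+p)}},\ \frac{d}{2^9\ln(MK/\gamma)}\Big(2^{\frac{1+3p+2\kappa(1+p)}{1+p}}\,(\min\{p,\ln(d)\})^{\kappa}\,\varepsilon\Big)^{\frac{2(1+p)}{1+\kappa(1+p)}}\bigg\}.$$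
   Context: Notation. $\ell_p^d=(\mathbb{R}^d,\|\cdot\|_p)$, with dual norm $\|\cdot\|_{p^*}$, $p^*=p/(p-1)$, and $\mathcal{B}_p^d$ is its unit ball centered at the origin. $1/\mathrm{poly}(d)$ stands for the reciprocal of an (unspecified) polynomial in $d$. Function classes. $\mathcal{F}^{\kappa}_{\ell_p^d}(\mu)$ is the class of convex functions $f:\mathbb{R}^d\to\mathbb{R}$ such that: if $\kappa=0$, $\|g_x-g_y\|_{p^*}\le\mu$ for all $x,y\in\mathbb{R}^d$ and all subgradients $g_x\in\partial f(x)$, $g_y\in\partial f(y)$; if $0<\kappa\le1$, $f$ is differentiable and $\|\nabla f(y)-\nabla f(x)\|_{p^*}\le\mu\|y-x\|_p^{\kappa}$ for all $x,y\in\mathbb{R}^d$. Oracle model. For a class $\mathcal{F}$ of convex functions on $\mathbb{R}^d$ and a feasible set $\mathcal{X}$, an $\varepsilon$-solution for $f\in\mathcal{F}$ is an $x\in\mathcal{X}$ with $f(x)-\inf_{\mathcal{X}}f\le\varepsilon$. An oracle $\mathcal{O}$ returns an answer $\mathcal{O}_f(x)$ for each $f\in\mathcal{F}$, $x\in\mathcal{X}$; it is local if $\mathcal{O}_f(x)=\mathcal{O}_g(x)$ whenever $f\equiv g$ in a neighborhood of $x$. A $K$-parallel deterministic algorithm works in rounds; in round $t$ it queries a batch $X^t=\{x_1^t,\ldots,x_K^t\}\subseteq\mathcal{X}$ and receives $\mathcal{O}_f(X^t)=(\mathcal{O}_f(x^t_1),\ldots,\mathcal{O}_f(x^t_K))$,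 where $X^1$ is fixed in advance and $X^{t+1}=U^{t+1}(X^1,\mathcal{O}_f(X^1),\ldots,X^t,\mathcal{O}_f(X^t))$ for deterministic functions $U^{t+1}$. $\mathcal{A}^K(\mathcal{O})$ is the set of such algorithms, and $T(A,f,\varepsilon)$ is the minimum number of rounds for algorithm $A$ run on $f$ to find (query) an $\varepsilon$-solution. With $\Delta(\mathcal{F})$ the set of probability distributions over $\mathcal{F}$, for $\gamma\in(0,1)$, $$\mathrm{Compl}_{\mathrm{HP}}^{\gamma}(\mathcal{F},\mathcal{X},K,\varepsilon)=\sup_{F\in\Delta(\mathcal{F})}\ \inf_{A\in\mathcal{A}^K(\mathcal{O})}\ \inf\{\tau:\ \mathbb{P}_{f\sim F}[T(A,f,\varepsilon)\le\tau]\ge\gamma\}.$$ *)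

(* Defs.v *)
From HB Require Import structures.
From mathcomp Require Import all_boot all_order all_algebra.
From mathcomp Require Import all_classical all_reals all_analysis.

Set Implicit Arguments.
Unset Strict Implicit.
Unset Printing Implicit Defensive.

Import Order.TTheory GRing.Theory Num.Theory.
Import numFieldNormedType.Exports.

Local Open Scope classical_set_scope.
Local Open Scope ring_scope.

Section lp_geometry.
Context {R : realType} {d : nat}.
Local Notation E := 'rV[R]_d.

(* The norm and topology that the library puts on 'rV[R]_d are those of the
   sup norm; the topology is also the one of every l_p norm. *)
Definition lpnorm (p : R) (x : E) : R := (\sum_i `|x 0 i| `^ p) `^ p^-1.

Definition conj_exp (p : R) : R := p / (p - 1).

Definition lpball (p : R) : set E := [set x | lpnorm p x <= 1].

Definition inner (g x : E) : R := \sum_i g 0 i * x 0 i.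

Definition subdifferential (f : E -> R) (x : E) : set E :=
  [set g | forall y, f x + inner g (y - x) <= f y].

Definition gradient (f : E -> R) (x : E) : E := \row_i 'D_(delta_mx 0 i) f x.

Definition smooth_class (p kappa mu : R) : set (E -> R) :=
  [set f | convex_function [set: E] f /\
    if kappa == 0 then
      forall x y gx gy, subdifferential f x gx -> subdifferential f y gy ->
        lpnorm (conj_exp p) (gx - gy) <= mu
    else
      (forall x, differentiable f x) /\
      (forall x y, lpnorm (conj_exp p) (gradient f y - gradient f x)
                   <= mu * lpnorm p (y - x) `^ kappa)].

End lp_geometry.

Section oracle_model.
Context {R : realType} {d : nat}.
Local Notation E := 'rV[R]_d.
Variables (F : set (E -> R)) (X : set E).

(* The infimum is taken in the extended reals: a function that is unbounded
   below on X has no eps-solution. *)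
Definition eps_solution (f : E -> R) (eps : R) (x : E) : Prop :=
  X x /\ ((f x)%:E - ereal_inf [set (f y)%:E | y in X] <= eps%:E)%E.

Variable Ans : Type.

Definition local_oracle (O : (E -> R) -> E -> Ans) : Prop :=
  forall f g x, F f -> F g -> X x ->
    (\forall y \near x, f y = g y) -> O f x = O g x.

Variable K : nat.

Definition history : Type := seq (('I_K -> E) * ('I_K -> Ans)).

(* [next_batch h] is the batch of round (size h).+1; in particular
   [next_batch [::]] is the batch fixed in advance. *)
Record algorithm : Type := Algorithm {
  next_batch : history -> 'I_K -> E ;
  next_batch_feasible : forall h k, X (next_batch h k) }.

Variable O : (E -> R) -> E -> Ans.

Fixpoint transcript (A : algorithm) (f : E -> R) (t : nat) : history :=
  if t is t'.+1 then
    let h := transcript A f t' in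
    let b := next_batch A h in
    rcons h (b, fun k => O f (b k))
  else [::].

Definition batch (A : algorithm) (f : E -> R) (t : nat) : 'I_K -> E :=
  next_batch A (transcript A f t).

(* Rounds are numbered from 1: [batch A f t] is queried in round t.+1. The
   value is +oo when no eps-solution is ever queried. *)
Definition num_rounds (A : algorithm) (f : E -> R) (eps : R) : \bar R :=
  ereal_inf [set (t.+1%:R)%:E |
    t in [set t | exists k, eps_solution f eps (batch A f t k)]].

(* A probability measure on some sigma-algebra over the space of all
   functions, concentrated on F. *)
Record distribution : Type := Distribution {
  dist_gen : set (set (E -> R)) ;
  dist_prob :> probability (g_sigma_algebraType dist_gen) R ;
  dist_measurable : <<s dist_gen >> F ;
  dist_supp : dist_prob F = 1%E }.

Definition success (A : algorithm) (eps : R) (tau : nat) : set (E -> R) :=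
  [set f | F f /\ (num_rounds A f eps <= (tau%:R)%:E)%E].

(* Oracles and algorithms are arbitrary functions, so these events need not be
   measurable, and then the value a library measure gives them is arbitrary.
   The supremum in [compl_hp] ranges over the distributions for which all the
   probabilities in its definition make sense; these include every
   distribution on the power set of the function space, hence every finitely
   supported one. *)
Definition admissible (D : distribution) (eps : R) : Prop :=
  forall A tau, <<s dist_gen D >> (success A eps tau).

Definition compl_hp (gamma eps : R) : \bar R :=
  ereal_sup [set
    ereal_inf [set
      ereal_inf [set (tau%:R)%:E |
        tau in [set tau : nat | (gamma%:E <= D (success A eps tau))%E]]
    | A in [set: algorithm]]
  | D in [set D : distribution | admissible D eps]].

End oracle_model.

(* Main.v *)
(* The coordinates are split into n blocks of length L, where n is the number of
   rounds to be defeated. A random sign vector on block i gives a linear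
   functional u_i, and the hard function is a scaled soft maximum of the entries
   u_i - i delta and of one convex "wall" per block, which takes over where that
   block of the query is large. A query of round t is independent of the signs
   of the blocks i >= t, so with high probability |u_i| is small there compared
   to the block norm (Hoeffding). The offsets i delta and the walls then keep
   the entries of the blocks i > t below the maximum by more than the width eta
   of the soft maximum, so a local oracle reveals at most one new block per
   round, and the value stays well above the minimum, which is attained near
   minus the sign vector.

   The soft maximum is the conjugate of c * \sum_k lambda_k ^ (1 + 1 / s) on the
   simplex. It depends only on the entries that are within eta of the maximum,
   and the uniform convexity of the power makes its gradient Lipschitz from l_p
   to its dual with constant of order s / eta; s is half of min(p, ln d). *)
Require Import Defs.
From HB Require Import structures.
From mathcomp Require Import all_boot all_order all_algebra.
From mathcomp Require Import all_classical all_reals all_analysis.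
From mathcomp Require Import ring lra.
Set Implicit Arguments.
Unset Strict Implicit.
Unset Printing Implicit Defensive.

Import Order.TTheory GRing.Theory Num.Theory.
Import numFieldNormedType.Exports.

Local Open Scope classical_set_scope.
Local Open Scope ring_scope.

(** * Powers, and a softmax whose gradient has local support *)

(** In a true run the queries are not independent of later signs, since every answer comes from the
    full function. Independence holds for a ghost run in which batch [t] is answered by the function
    whose signs after block [t] are zeroed; unless a tail event occurs, both runs coincide. Locality
    of the oracle needs equality on a neighborhood, so the weights must vanish exactly, which those
    of log-sum-exp never do. The walls are there because [X] may be unbounded: Hoeffding controls
    [u_i] only relative to the block norm.

    All [kappa] are treated at once: a function with bounded and Lipschitz gradient becomes Hoelder
    after one rescaling.

    The minimum over the ball is at most [- n ^ (- 1 / p)] before rescaling, hence at most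
    [- sigma]. The widths and offsets are multiples of [omega = sigma ^ (1 + p)], and the first term
    of the minimum says [M sigma ^ p <= 1], so [n] offsets use up only a fraction of [sigma]. The
    second term makes blocks of length about [d / n] long enough for deviations of order [omega] to
    survive a union bound over rounds, queries and blocks. *)

Section scalar_inequalities.
Context {R : realType}.
Implicit Types a b s t x y : R.

Lemma powR_AMGM x y t : 0 <= x -> 0 <= y -> 0 <= t <= 1 ->
  x `^ (1 - t) * y `^ t <= (1 - t) * x + t * y.
Proof.
move=> x0 y0 /andP[]; rewrite le_eqVlt => /predU1P[<- _|t0].
  by rewrite subr0 powRr0 powRr1// !mul1r mul0r mulr1 addr0.
rewrite le_eqVlt => /predU1P[->|t1].
  by rewrite subrr powRr0 powRr1// !mul1r mul0r add0r.
have u0 : 0 < 1 - t by lra.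
have := @conjugate_powR R (x `^ (1 - t)) (y `^ t) (1 - t)^-1 t^-1.
rewrite !powR_ge0 !invr_gt0 u0 t0 !invrK -!powRrM !divff ?gt_eqF//.
rewrite !powRr1// => /(_ isT isT isT isT); rewrite subrK => /(_ erefl).
by rewrite [x * _]mulrC [y * _]mulrC.
Qed.

(** This is the tangent line of the power at [a], rearranged; weighted AM-GM replaces
    differentiation. *)
Lemma powR_tangent a b s : 0 <= a -> 0 <= b -> 1 <= s ->
  s * a `^ (s - 1) * b <= (s - 1) * a `^ s + b `^ s.
Proof.
move=> a0 b0 s1; have s0 : 0 < s by lra.
have := @powR_AMGM (a `^ s) (b `^ s) s^-1 (powR_ge0 _ _) (powR_ge0 _ _).
rewrite invr_ge0 ltW// invf_le1// s1 => /(_ isT).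
rewrite -!powRrM mulrBr mulr1 divff ?gt_eqF// powRr1// => h.
have := ler_wpM2l (ltW s0) h; rewrite mulrA => /le_trans; apply.
by rewrite mulrDr !mulrA mulrBr mulr1 divff ?gt_eqF// mul1r.
Qed.

Lemma powR_diff_le a b s : 0 <= b -> b <= a -> 1 <= s ->
  a `^ s - b `^ s <= s * a `^ (s - 1) * (a - b).
Proof.
move=> b0 ba s1; have a0 := le_trans b0 ba.
have := powR_tangent a0 b0 s1.
have := @mulr_powRB1 R a s a0 (lt_le_trans ltr01 s1).
by move: (a `^ s) (a `^ (s - 1)) (b `^ s) => A A' B; nra.
Qed.

Lemma powR_le a b s : 0 <= s -> 0 <= b -> b <= a -> b `^ s <= a `^ s.
Proof.
by move=> s0 b0 ba; rewrite ge0_ler_powR// nnegrE// (le_trans b0).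
Qed.

Lemma powR_max a b s : 0 <= s -> 0 <= a -> 0 <= b ->
  Num.max a b `^ s = Num.max (a `^ s) (b `^ s).
Proof.
move=> s0 a0 b0; have /orP[ab|ba] := le_total a b.
  by rewrite (max_idPr ab) (max_idPr (powR_le s0 a0 ab)).
by rewrite (max_idPl ba) (max_idPl (powR_le s0 b0 ba)).
Qed.

Lemma powR_diff_mul_ge0 a b s : 0 <= s -> 0 <= a -> 0 <= b ->
  0 <= (a `^ s - b `^ s) * (a - b).
Proof.
move=> s0 a0 b0; have /orP[ab|ba] := le_total a b.
  by rewrite mulr_le0 ?subr_le0// powR_le.
by rewrite mulr_ge0 ?subr_ge0// powR_le.
Qed.

Lemma powR_div x y t : 0 <= x -> 0 <= y -> (x / y) `^ t = x `^ t / y `^ t.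
Proof.
move=> x0 y0; rewrite powRM ?invr_ge0//; congr (_ * _).
by rewrite -(powR_inv1 y0) -powRrM mulN1r powRN.
Qed.

(** For excesses [a] and [b] this bounds a squared difference of weights by its monotone pairing
    with the difference of excesses, ready for Cauchy-Schwarz. *)
Lemma powR_diff_sqr_le a b s : 0 <= a -> 0 <= b -> 1 <= s ->
  (a `^ s - b `^ s) ^+ 2 <=
  s * Num.max a b `^ (s - 1) * ((a `^ s - b `^ s) * (a - b)).
Proof.
move=> a0 b0 s1; wlog ba : a b a0 b0 / b <= a.
  move=> h; have /orP[ba|ab] := le_total b a; first exact: h.
  rewrite -[leLHS]sqrrN opprB maxC -[X in _ <= _ * X]mulrNN !opprB.
  exact: h.
rewrite (max_idPl ba) expr2 mulrCA ler_wpM2l ?powR_diff_le//.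
by rewrite subr_ge0 ge0_ler_powR// ltW// (lt_le_trans ltr01).
Qed.

Lemma lipschitz_within_continuous (f : R -> R) (C : R) (A : set R) :
  (forall x y, `|f x - f y| <= C * `|x - y|) -> {within A, continuous f}.
Proof.
move=> fC; apply: continuous_subspaceT => x.
have C0 : 0 < Num.max C 1 by rewrite lt_max ltr01 orbT.
apply/cvgrPdist_lt => e e0; near=> y.
apply: (le_lt_trans (fC _ _)).
apply: (@le_lt_trans _ _ (Num.max C 1 * `|x - y|)).
  by rewrite ler_wpM2r// le_max lexx.
rewrite mulrC -ltr_pdivlMr//; near: y.
by move: (divr_gt0 e0 C0); apply: cvgr_dist_lt; exact: cvg_id.
Unshelve. all: by end_near. Qed.

Lemma powR_clip_lipschitz s x y : 1 <= s ->
  `|Num.max 0 (Num.min 1 x) `^ s - Num.max 0 (Num.min 1 y) `^ s|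
    <= s * `|x - y|.
Proof.
move=> s1; have s0 : 0 <= s by lra.
wlog yx : x y / y <= x.
  move=> h; have /orP[yx|xy] := le_total y x; first exact: h.
  by rewrite distrC [`|x - y|]distrC; exact: h.
rewrite [X in _ * X]ger0_norm ?subr_ge0//.
set a := Num.max 0 (Num.min 1 x); set b := Num.max 0 (Num.min 1 y).
have a0 : 0 <= a by rewrite le_max lexx.
have b0 : 0 <= b by rewrite le_max lexx.
have ba : b <= a.
  rewrite /b ge_max a0/= le_max; apply/orP; right.
  by rewrite le_min !ge_min lexx yx orbT.
have ab : a - b <= x - y.
  have b1 : Num.min 1 y <= b by rewrite le_max lexx orbT.
  rewrite lerBlDr ge_max addr_ge0 ?subr_ge0//=.
  apply: le_trans (lerD (lexx (x - y)) b1).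
  by rewrite addr_minr subrK le_min !ge_min lexx orbT andbT lerDr subr_ge0 yx.
have a1 : a <= 1 by rewrite /a ge_max ler01 ge_min lexx.
rewrite ger0_norm ?subr_ge0 ?ge0_ler_powR//.
apply: (le_trans (powR_diff_le b0 ba s1)).
apply: ler_pM; rewrite ?mulr_ge0 ?powR_ge0 ?subr_ge0// ler_piMr//.
move: a0; rewrite le_eqVlt => /predU1P[<-|a0].
  by have [->|?] := eqVneq (s - 1) 0; rewrite ?powRr0// powR0.
by rewrite -[leRHS](powRr0 a) ger_powR ?a0//; lra.
Qed.

(** A hypothesis on squares avoids roots of [e] and [f]. The quadratic in [t] is nonnegative term by
    term and is evaluated at its minimizer [X / E]. *)
Lemma sum_cauchy_schwarz (I : finType) (x e f : I -> R) :
  (forall k, 0 <= e k) -> (forall k, 0 <= f k) ->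
  (forall k, x k ^+ 2 <= e k * f k) ->
  (\sum_k x k) ^+ 2 <= (\sum_k e k) * (\sum_k f k).
Proof.
move=> e0 f0 xef; have E0 : 0 <= \sum_k e k by exact: sumr_ge0.
set E := \sum_k e k in E0 *; set X := \sum_k x k; set F := \sum_k f k.
move: (E0); rewrite le_eqVlt => /predU1P[EE|Ep].
  have x0 k : x k = 0.
    have ek : e k = 0.
      apply/eqP; move/esym/eqP: EE; rewrite /E psumr_eq0// => /allP/(_ k).
      by rewrite mem_index_enum; apply.
    have := xef k; rewrite ek mul0r => h.
    by apply/eqP; rewrite -sqrf_eq0 eq_le h sqr_ge0.
  by rewrite -EE mul0r /X big1// expr0n.
have q t : 0 <= t ^+ 2 * E - 2 * t * X + F.
  rewrite /E /X /F !mulr_sumr -sumrB -big_split/= sumr_ge0// => k _.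
  have := xef k; have := f0 k.
  have := e0 k; rewrite le_eqVlt => /predU1P[<- fk|ek fk h].
    rewrite mul0r => h; have /eqP -> : x k == 0.
      by rewrite -sqrf_eq0 eq_le h sqr_ge0.
    by rewrite !mulr0 subr0 add0r.
  by rewrite -(pmulr_rge0 _ ek); have := sqr_ge0 (e k * t - x k); nra.
have := q (X / E); rewrite -(pmulr_rge0 _ Ep).
have -> : E * ((X / E) ^+ 2 * E - 2 * (X / E) * X + F) = E * F - X ^+ 2.
  by field; rewrite gt_eqF.
by rewrite subr_ge0.
Qed.

End scalar_inequalities.

(** * The soft maximum: level, weights, subgradients, Lipschitz bound *)

Section softmax.
Context {R : realType} {T : finType} (t0 : T) (eta s : R).
Hypotheses (eta_gt0 : 0 < eta) (s_ge1 : 1 <= s).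
Implicit Types v w : T -> R.

Let s_gt0 : 0 < s. Proof. exact: lt_le_trans s_ge1. Qed.

Definition excess v (tau : R) k : R := Num.max 0 ((v k - tau) / eta).

Lemma excess_ge0 v tau k : 0 <= excess v tau k.
Proof. by rewrite le_max lexx. Qed.

(** At [tau = max v] all excesses vanish; at [max v - eta] the largest entry alone contributes 1.
    The intermediate value theorem does the rest. *)
Lemma softmax_level_exists v : exists tau : R,
  (forall k, v k <= tau + eta) /\ \sum_k excess v tau k `^ s = 1.
Proof.
have [m _ vm] := @arg_maxP _ _ _ t0 xpredT v isT.
(* Clipping at 1 makes each summand Lipschitz, hence continuous; it is inactive at the level found,
   which is at least [v m - eta]. *)
pose g tau := \sum_k Num.max 0 (Num.min 1 ((v k - tau) / eta)) `^ s.
have gc : {within `[v m - eta, v m], continuous g}.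
  apply: (@lipschitz_within_continuous _ _ (\sum_(k in T) s / eta)) => x y.
  rewrite /g -sumrB (le_trans (ler_norm_sum _ _ _))// mulr_suml ler_sum// => k _.
  apply: (le_trans (powR_clip_lipschitz _ _ s_ge1)).
  rewrite -mulrBl normrM [`|eta^-1|]gtr0_norm ?invr_gt0// -mulrA ler_pM2l//.
  by rewrite mulrC ler_pM2l ?invr_gt0// opprB addrC addrA subrK distrC.
have g0 : g (v m) = 0.
  rewrite /g big1// => k _; rewrite (max_idPl _) ?powR0 ?gt_eqF//.
  by rewrite ge_min pmulr_lle0 ?invr_gt0// subr_le0 [v k <= _]vm// orbT.
have g1 : 1 <= g (v m - eta).
  rewrite /g (bigD1 m)//= subKr divff ?gt_eqF// minxx.
  rewrite (max_idPr ler01) powR1 lerDl sumr_ge0// => k _; exact: powR_ge0.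
have [||tau] := @IVT R g (v m - eta) (v m) 1 _ gc.
- by rewrite lerBlDr lerDl ltW.
- by rewrite g0 ge_min ler01 orbT le_max g1.
rewrite in_itv/= => /andP[tau1 tau2] gtau; exists tau.
have vtau k : v k <= tau + eta by rewrite (le_trans (vm k isT))//; lra.
split=> //; rewrite -{}[RHS]gtau; apply: eq_bigr => k _; congr (_ `^ _).
congr Num.max; rewrite (min_idPr _)// ler_pdivrMr// mul1r.
by rewrite lerBlDl.
Qed.

Definition softmax_level v : R := projT1 (cid (softmax_level_exists v)).

(* Locked because unification otherwise unfolds the power into a series. *)
Definition softmax_weight : (T -> R) -> T -> R :=
  locked (fun v k => excess v (softmax_level v) k `^ s).

Lemma softmax_weightE v k :
  softmax_weight v k = excess v (softmax_level v) k `^ s.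
Proof. by rewrite /softmax_weight -lock. Qed.

(* Equals [min_tau tau + eta / (s + 1) * \sum_k excess v tau k `^ (s + 1)];
   [softmax_level v] is the minimizer, and the weights are the gradient. *)
Definition softmax : (T -> R) -> R := locked (fun v => softmax_level v +
  eta / (s + 1) * \sum_k excess v (softmax_level v) k `^ (s + 1)).

Let softmaxE v : softmax v = softmax_level v +
  eta / (s + 1) * \sum_k excess v (softmax_level v) k `^ (s + 1).
Proof. by rewrite /softmax -lock. Qed.

Lemma softmax_level_ge v k : v k <= softmax_level v + eta.
Proof. by have [+ _] := projT2 (cid (softmax_level_exists v)); exact. Qed.

Lemma softmax_weight_sum v : \sum_k softmax_weight v k = 1.
Proof.
rewrite /softmax_weight -lock.
by have [] := projT2 (cid (softmax_level_exists v)).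
Qed.

Lemma softmax_weight_ge0 v k : 0 <= softmax_weight v k.
Proof. by rewrite softmax_weightE powR_ge0. Qed.

Lemma softmax_weight_eq0 v k l : v k + eta <= v l -> softmax_weight v k = 0.
Proof.
move=> vkl; rewrite softmax_weightE /excess (max_idPl _) ?powR0 ?gt_eqF//.
rewrite pmulr_lle0 ?invr_gt0// subr_le0.
by have := le_trans vkl (softmax_level_ge v l); rewrite lerD2r.
Qed.

Let excess_level_le v w k : softmax_weight v k * (w k - softmax_level w)
  <= softmax_weight v k * (excess w (softmax_level w) k * eta).
Proof.
rewrite ler_wpM2l ?softmax_weight_ge0// -ler_pdivrMr//.
by rewrite le_max lexx orbT.
Qed.

Let weight_excess v k : softmax_weight v k * (v k - softmax_level v) =
  softmax_weight v k * (excess v (softmax_level v) k * eta).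
Proof.
rewrite softmax_weightE /excess; case: leP => h.
  by rewrite divfK ?gt_eqF.
by rewrite powR0 ?gt_eqF// !mul0r.
Qed.

(** Termwise it is the tangent inequality for the power [s + 1] between the two excesses. The change
    of level factors out because the weights sum to 1. *)
Lemma softmax_subgradient v w :
  softmax v + \sum_k softmax_weight v k * (w k - v k) <= softmax w.
Proof.
rewrite !softmaxE; set t := softmax_level v; set t' := softmax_level w.
have -> : \sum_k softmax_weight v k * (w k - v k) =
    t' - t + \sum_k softmax_weight v k * ((w k - t') - (v k - t)).
  rewrite [X in _ = _ + X](eq_bigr (fun k => softmax_weight v k * (w k - v k) -
    (t' - t) * softmax_weight v k)); last by move=> k _; ring.
  by rewrite sumrB -mulr_sumr softmax_weight_sum mulr1 addrC subrK.
suff h : \sum_k (eta / (s + 1) * excess v t k `^ (s + 1) +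
    softmax_weight v k * (w k - t' - (v k - t))) <=
    \sum_k eta / (s + 1) * excess w t' k `^ (s + 1).
  rewrite addrACA (addrC t) subrK lerD2l; move: h; clearbody t t'.
  move: (eta / (s + 1)) (excess v t) (excess w t') (softmax_weight v) => c A B L.
  by rewrite big_split/= !mulr_sumr.
apply: ler_sum => k _.
have s1 : 1 <= s + 1 by rewrite lerDr ltW.
have s1_gt0 : 0 < s + 1 by exact: lt_le_trans s1.
have := powR_tangent (excess_ge0 v t k) (excess_ge0 w t' k) s1.
rewrite addrK -softmax_weightE => tg.
have e2 := weight_excess v k.
have e3 : softmax_weight v k * excess v t k = excess v t k `^ (s + 1).
  by rewrite mulrC -(mulr_powRB1 (excess_ge0 _ _ _) s1_gt0) addrK softmax_weightE.
have e4 := excess_level_le v w k.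
have c0 : 0 < eta / (s + 1) by rewrite divr_gt0.
have := ler_wpM2l (ltW c0) tg.
set c := eta / (s + 1) in c0 *; have cE : c * (s + 1) = eta.
  by rewrite divfK// gt_eqF.
have e5 : softmax_weight v k * (excess v t k * eta) =
    c * (s + 1) * excess v t k `^ (s + 1) by rewrite -e3 cE; ring.
have e6 : softmax_weight v k * (excess w t' k * eta) =
    c * ((s + 1) * softmax_weight v k * excess w t' k) by rewrite -cE; ring.
rewrite [softmax_weight v k * _]mulrBr e2 -/t e5 => h.
apply: (le_trans (lerD (lexx _) (lerD e4 (lexx _)))); rewrite e6.
move: h; clearbody c; move: (excess v t k `^ (s + 1)) => A.
move: (excess w t' k `^ (s + 1)) ((s + 1) * softmax_weight v k * _) => B C.
move=> h; rewrite -subr_ge0; move: h; rewrite -subr_ge0.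
by congr (is_true (0 <= _)); ring.
Qed.

Lemma softmax_ge v k : v k - eta <= softmax v.
Proof.
rewrite softmaxE; have := softmax_level_ge v k; rewrite lerBlDr => /le_trans; apply.
rewrite lerD2r lerDl mulr_ge0 ?divr_ge0 ?addr_ge0 ?(ltW s_gt0) ?(ltW eta_gt0)//.
by rewrite sumr_ge0// => l _; exact: powR_ge0.
Qed.

(** Here [eta] times the power sum is the weighted average of [v k - t], at most [c - t], and
    division by [s + 1] only lowers it. *)
Lemma softmax_le v c : (forall k, v k <= c) -> softmax v <= c.
Proof.
move=> vc; rewrite softmaxE; set t := softmax_level v.
have e k : eta * excess v t k `^ (s + 1) = softmax_weight v k * (v k - t).
  rewrite weight_excess -[in LHS](mulr_powRB1 (excess_ge0 _ _ _)); last exact: ltr_wpDr.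
  by rewrite addrK softmax_weightE -/t; ring.
have le : eta * (\sum_k excess v t k `^ (s + 1)) <= c - t.
  have -> : c - t = \sum_k softmax_weight v k * (c - t).
    by rewrite -mulr_suml softmax_weight_sum mul1r.
  rewrite mulr_sumr ler_sum// => k _.
  by rewrite e ler_wpM2l ?softmax_weight_ge0// lerB.
have ge : 0 <= eta * (\sum_k excess v t k `^ (s + 1)).
  by rewrite mulr_ge0 ?(ltW eta_gt0)// sumr_ge0// => k _; exact: powR_ge0.
rewrite mulrAC -lerBrDl; apply: le_trans le.
by rewrite ler_pdivrMr ?ltr_wpDr// ler_peMr// lerDr ltW.
Qed.

(** In the subgradient inequality, taken in both directions, each differing entry has weight 0. *)
Lemma softmax_eq v w :
  (forall k, v k = w k \/ (exists l, v k + eta <= v l) /\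
                          (exists l, w k + eta <= w l)) ->
  softmax v = softmax w.
Proof.
move=> h.
have le v1 w1 : (forall k, v1 k = w1 k \/ (exists l, v1 k + eta <= v1 l)) ->
    softmax v1 <= softmax w1.
  move=> h1; apply: le_trans (softmax_subgradient v1 w1).
  rewrite big1 ?addr0// => k _.
  have [->|[l /softmax_weight_eq0->]] := h1 k; last by rewrite mul0r.
  by rewrite subrr mulr0.
apply/le_anti/andP; split; apply: le => k; have [hk|[]] := h k; by [left|right].
Qed.

(* Cauchy-Schwarz is applied twice: the weight differences are controlled by
   their pairing with the differences of the excesses, and that pairing by the
   weight differences. *)
Lemma softmax_weight_lipschitz v w (V B : T -> R) (C P Q : R) :
  (forall k, `|v k - w k| <= V k) ->
  0 <= C -> 0 <= P -> 0 <= Q ->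
  let m k := Num.max (softmax_weight v k) (softmax_weight w k) in
  \sum_k m k `^ (1 - s^-1) * V k ^+ 2 <= C * P ^+ 2 ->
  \sum_k m k `^ (1 - s^-1) * B k ^+ 2 <= C * Q ^+ 2 ->
  \sum_k `|softmax_weight v k - softmax_weight w k| * B k
    <= s / eta * C * P * Q.
Proof.
move=> vw C0 P0 Q0 /=.
have := softmax_weight_sum w; have := softmax_weight_sum v.
have := excess_level_le w v; have := excess_level_le v w.
have := weight_excess w; have := weight_excess v.
have lE k : softmax_weight v k = excess v (softmax_level v) k `^ s.
  exact: softmax_weightE.
have mE k : softmax_weight w k = excess w (softmax_level w) k `^ s.
  exact: softmax_weightE.
move: (excess_ge0 v (softmax_level v)) (excess_ge0 w (softmax_level w)) lE mE.
move: (softmax_weight v) (softmax_weight w) => l l'.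
move: (excess v (softmax_level v)) (excess w (softmax_level w)) => a b.
move: (softmax_level v) (softmax_level w) => t t'.
move=> a0 b0 lE l'E va wb vb wa l1 l'1.
set m := fun k => Num.max (l k) (l' k); rewrite -/m => hP hQ.
pose D k := l k - l' k.
pose e k := D k * (a k - b k).
have e0 k : 0 <= e k.
  by rewrite /e /D lE l'E; exact: powR_diff_mul_ge0 (ltW s_gt0) (a0 k) (b0 k).
have De k : D k ^+ 2 <= s * m k `^ (1 - s^-1) * e k.
  have -> : m k `^ (1 - s^-1) = Num.max (a k) (b k) `^ (s - 1).
    rewrite /m lE l'E -(powR_max (ltW s_gt0) (a0 k) (b0 k)).
    by rewrite -powRrM mulrBr mulr1 divff ?gt_eqF.
  by rewrite /e /D lE l'E; exact: powR_diff_sqr_le.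
have CS (f : T -> R) c : \sum_k m k `^ (1 - s^-1) * f k ^+ 2 <= c ->
    (\sum_k `|D k| * f k) ^+ 2 <= (\sum_k e k) * (s * c).
  move=> fc; have := @sum_cauchy_schwarz _ _ (fun k => `|D k| * f k) e
    (fun k => s * (m k `^ (1 - s^-1) * f k ^+ 2)).
  move/(_ e0) => h; apply: (le_trans (h _ _)).
  - move=> k; rewrite mulr_ge0 ?(ltW s_gt0)// mulr_ge0 ?powR_ge0//.
    exact: sqr_ge0.
  - move=> k; rewrite exprMn real_normK ?num_real//.
    have := ler_wpM2r (sqr_ge0 (f k)) (De k).
    by move=> /le_trans; apply; rewrite le_eqVlt; apply/orP; left; apply/eqP; ring.
  rewrite ler_wpM2l ?sumr_ge0// -mulr_sumr ler_wpM2l//; exact: ltW.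
set Y := \sum_k `|D k| * V k.
set X := \sum_k `|D k| * B k.
(* The weight differences sum to 0, so the levels may be subtracted for free; then entries are
   exchanged for excesses, exactly where the weight is positive. *)
have EY : eta * (\sum_k e k) <= Y.
  have : \sum_k D k * ((v k - t) - (w k - t')) <= Y.
    have DS : \sum_k D k = 0 by rewrite sumrB l1 l'1 subrr.
    have -> : \sum_k D k * ((v k - t) - (w k - t')) =
        \sum_k (D k * (v k - w k) + (t' - t) * D k).
      by apply: eq_bigr => k _; ring.
    rewrite big_split/= -[X in _ + X <= _]mulr_sumr DS mulr0 addr0.
    apply: ler_sum => k _; apply: (le_trans (ler_norm _)); rewrite normrM.
    by rewrite ler_wpM2l.
  apply: le_trans; rewrite mulr_sumr ler_sum// => k _.
  rewrite /e /D; move: (va k) (wb k) (vb k) (wa k) => {}va {}wb {}vb {}wa.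
  rewrite -subr_ge0 (_ : _ - _ = (l k * (b k * eta) - l k * (w k - t')) +
    (l' k * (a k * eta) - l' k * (v k - t))); first by rewrite addr_ge0// subr_ge0.
  by rewrite !mulrBl !mulrBr in va wb *; lra.
have E0 : 0 <= \sum_k e k by exact: sumr_ge0.
have YP := CS V _ hP; have XQ := CS B _ hQ.
rewrite -/Y -/X !(mulrA s) in YP XQ.
have Y0 : 0 <= Y by rewrite (le_trans _ EY)// mulr_ge0// ltW.
have ie0 : 0 < eta^-1 by rewrite invr_gt0.
have EY' : \sum_k e k <= eta^-1 * Y by rewrite mulrC ler_pdivlMr// mulrC.
have sC : 0 <= s * C by rewrite mulr_ge0// ltW.
have sCP : 0 <= s * C * P ^+ 2 by rewrite mulr_ge0// sqr_ge0.
(* [Y ^ 2] is at most a constant times [Y], so one factor [Y] cancels. *)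
have YP' : Y <= eta^-1 * (s * C * P ^+ 2).
  move: Y0; rewrite le_eqVlt => /predU1P[<-|Y0]; first by rewrite mulr_ge0// ltW.
  rewrite -(ler_pM2l Y0) -expr2 (le_trans YP)// (le_trans (ler_wpM2r sCP EY'))//.
  by rewrite mulrAC mulrC.
have K0 : 0 <= s / eta * C * P * Q by rewrite !mulr_ge0// ltW// divr_gt0.
have [X0|/ltW X0] := leP X 0; first exact: le_trans X0 K0.
rewrite -(@ler_pXn2r _ 2)//.
apply: (le_trans XQ).
have sCQ : 0 <= s * C * Q ^+ 2 by rewrite mulr_ge0// sqr_ge0.
apply: (le_trans (ler_wpM2r sCQ EY')).
have := ler_wpM2r sCQ (ler_wpM2l (ltW ie0) YP').
by move/le_trans; apply; rewrite le_eqVlt; apply/orP; left; apply/eqP; ring.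
Qed.

End softmax.

(** * Duality and membership in the class *)

Section lp_duality.
Context {R : realType} {d : nat}.
Local Notation E := 'rV[R]_d.
Implicit Types (p c : R) (g h x y : E).

Lemma lpnorm_ge0 p x : 0 <= lpnorm p x.
Proof. exact: powR_ge0. Qed.

Lemma lpnormN p x : lpnorm p (- x) = lpnorm p x.
Proof.
by congr (_ `^ _); apply: eq_bigr => i _; rewrite mxE normrN.
Qed.

Lemma lpnormB p x y : lpnorm p (x - y) = lpnorm p (y - x).
Proof. by rewrite -lpnormN opprB. Qed.

Lemma lpnorm_powR p x : 0 < p -> lpnorm p x `^ p = \sum_i `|x 0 i| `^ p.
Proof.
move=> p0; rewrite -powRrM mulVf ?gt_eqF// powRr1// sumr_ge0//.
Qed.

Lemma le_coord_norm x i : `|x 0 i| <= `|x|.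
Proof.
rewrite [`|x|]/Num.norm/= mx_normrE.
by apply: (le_trans _ (le_bigmax _ _ (0, i))).
Qed.

Lemma lpnorm_le_norm p x : 0 < p -> lpnorm p x <= d%:R `^ p^-1 * `|x|.
Proof.
move=> p0; have -> : `|x| = (`|x| `^ p) `^ p^-1.
  by rewrite -powRrM mulfV ?gt_eqF// powRr1.
rewrite -powRM ?powR_ge0// powR_le ?invr_ge0 ?(ltW p0)//.
  by rewrite sumr_ge0//.
apply: (@le_trans _ _ (\sum_(i < d) `|x| `^ p)).
  by apply: ler_sum => i _; rewrite powR_le ?(ltW p0)// le_coord_norm.
by rewrite sumr_const card_ord mulr_natl.
Qed.

Lemma innerDl g h x : inner (g + h) x = inner g x + inner h x.
Proof.
by rewrite /inner -big_split/=; apply: eq_bigr => i _; rewrite mxE mulrDl.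
Qed.

Lemma innerNl g x : inner (- g) x = - inner g x.
Proof. by rewrite /inner -sumrN; apply: eq_bigr => i _; rewrite mxE mulNr. Qed.

Lemma innerBl g h x : inner (g - h) x = inner g x - inner h x.
Proof. by rewrite innerDl innerNl. Qed.

Lemma innerZl c g x : inner (c *: g) x = c * inner g x.
Proof.
by rewrite /inner mulr_sumr; apply: eq_bigr => i _; rewrite mxE mulrA.
Qed.

Lemma inner_linear g : linear (inner g : E -> R).
Proof.
move=> c x y; rewrite /inner scaler_sumr -big_split/=; apply: eq_bigr => i _.
by rewrite !mxE mulrDr; congr (_ + _); rewrite /GRing.scale/= mulrCA.
Qed.

HB.instance Definition _ g :=
  GRing.isLinear.Build R E R *:%R (inner g : E -> R) (inner_linear g).

Lemma inner_delta g i : inner g (delta_mx 0 i) = g 0 i.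
Proof.
rewrite /inner (bigD1 i)//= mxE !eqxx mulr1 big1 ?addr0// => j /negPf ji.
by rewrite mxE ji andbF mulr0.
Qed.

Lemma norm_inner_le g x : `|inner g x| <= (\sum_i `|g 0 i|) * `|x|.
Proof.
rewrite (le_trans (ler_norm_sum _ _ _))// mulr_suml ler_sum// => i _.
by rewrite normrM ler_wpM2l// le_coord_norm.
Qed.

Lemma inner_continuous g : continuous (inner g : E -> R).
Proof.
apply/linear_bounded_continuous.
exists (\sum_i `|g 0 i|); split; first exact: num_real.
move=> M gM; near=> x; apply: le_trans (ltW gM).
apply: le_trans (norm_inner_le _ _) _.
rewrite ler_piMr ?sumr_ge0//; near: x; exact: nbhs0_le.
Unshelve. all: by end_near. Qed.

(* The test vector is [sg (g i) * |g i|^(q - 1)] with [q = conj_exp p]. *)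
Lemma lpnorm_conj_exp_le p c g : 1 < p -> 0 <= c ->
  (forall h, inner g h <= c * lpnorm p h) -> lpnorm (conj_exp p) g <= c.
Proof.
move=> p1 c0 gc; rewrite /lpnorm; set q := conj_exp p.
have p0 : 0 < p by lra.
have qE : q = p / (p - 1) by [].
have pm0 : 0 < p - 1 by rewrite subr_gt0.
have q0 : 0 < q by rewrite qE divr_gt0.
have q1 : q - 1 = (p - 1)^-1 by rewrite qE; field; rewrite gt_eqF.
set N := \sum_i _.
have N0 : 0 <= N by rewrite sumr_ge0//.
move: (N0); rewrite le_eqVlt => /predU1P[<-|Np].
  by rewrite powR0 ?invr_eq0 ?gt_eqF.
pose h : E := \row_i (Num.sg (g 0 i) * `|g 0 i| `^ (q - 1)).
have gh : inner g h = N.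
  apply: eq_bigr => i _; rewrite mxE mulrA -[_ * Num.sg _]mulrC -normrEsg.
  exact: mulr_powRB1.
have hN : lpnorm p h = N `^ p^-1.
  congr (_ `^ _); apply: eq_bigr => i _; rewrite mxE.
  have [->|gi0] := eqVneq (g 0 i) 0.
    by rewrite sgr0 mul0r normr0 !powR0 ?gt_eqF.
  rewrite normrM normr_sg gi0 mul1r ger0_norm ?powR_ge0// -powRrM.
  by congr (_ `^ _); rewrite q1 qE mulrC.
have := gc h; rewrite gh hN.
have -> : q^-1 = 1 - p^-1 by rewrite qE; field; rewrite !gt_eqF.
clearbody N; rewrite powRB ?(gt_eqF Np) ?implybT//.
by rewrite (powRr1 N0) ler_pdivrMr ?powR_gt0.
Qed.

End lp_duality.

(** * Rescaling into the Hoelder class *)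

Section membership.
Context {R : realType} {d : nat}.
Local Notation E := 'rV[R]_d.
Variables (p kappa Lam : R) (f : E -> R) (G : E -> E).
Hypotheses (p_gt1 : 1 < p) (kappa01 : 0 <= kappa <= 1) (Lam_gt0 : 0 < Lam).
Hypothesis subgradient : forall x y, f x + inner (G x) (y - x) <= f y.
Hypothesis bounded : forall x h, inner (G x) h <= lpnorm p h.
Hypothesis lipschitz : forall x y h,
  inner (G y - G x) h <= Lam * lpnorm p (y - x) * lpnorm p h.

(** The bounds [2] and [Lam * r] on a gradient change cross at [r = 2 / Lam]; this is the largest
    factor that brings the crossing value below [r ^ kappa]. *)
Definition hoelder_scale : R := 2^-1 * (2 / Lam) `^ kappa.

Local Notation theta := hoelder_scale.
Local Notation F := (fun x => theta * f x).

Let p_gt0 : 0 < p. Proof. exact: lt_trans p_gt1. Qed.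

Lemma hoelder_scale_gt0 : 0 < theta.
Proof. by rewrite mulr_gt0 ?invr_gt0 ?powR_gt0 ?divr_gt0. Qed.

Let F_subgradient x y : F x + inner (theta *: G x) (y - x) <= F y.
Proof. by rewrite innerZl -mulrDr ler_wpM2l ?subgradient// ltW// hoelder_scale_gt0. Qed.

(* [theta * min 2 (Lam * r) <= r `^ kappa] *)
Let F_hoelder x y h : inner (theta *: G y - theta *: G x) h
  <= lpnorm p (y - x) `^ kappa * lpnorm p h.
Proof.
have /andP[k0 k1] := kappa01.
rewrite -scalerBr innerZl; set r := lpnorm p (y - x).
have r0 : 0 <= r := lpnorm_ge0 _ _.
have c0 : 0 <= 2 / Lam by rewrite divr_ge0// ltW.
have th0 := ltW hoelder_scale_gt0.
have [rL|Lr] := leP r (2 / Lam).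
  apply: (le_trans (ler_wpM2l th0 (lipschitz x y h))); rewrite -/r mulrA.
  rewrite ler_wpM2r ?lpnorm_ge0//.
  move: r0; rewrite le_eqVlt => /predU1P[<-|r0].
    by rewrite !mulr0 powR_ge0.
  rewrite /theta.
  have -> : 2^-1 * (2 / Lam) `^ kappa * (Lam * r) =
      (2 / Lam) `^ kappa * (r / (2 / Lam)).
    by field; rewrite gt_eqF.
  have -> : r `^ kappa = (2 / Lam) `^ kappa * (r / (2 / Lam)) `^ kappa.
    rewrite -(powRM _ c0 (divr_ge0 (ltW r0) c0)) mulrC divfK//.
    by rewrite gt_eqF ?divr_gt0.
  rewrite ler_wpM2l ?powR_ge0// ger1_powR// divr_gt0 ?divr_gt0//=.
  by rewrite ler_pdivrMr ?mul1r// divr_gt0.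
have G2 : inner (G y - G x) h <= 2 * lpnorm p h.
  have := bounded x (- h); rewrite lpnormN linearN/= innerBl.
  by have := bounded y h; lra.
apply: (le_trans (ler_wpM2l th0 G2)); rewrite mulrA ler_wpM2r ?lpnorm_ge0//.
rewrite /theta mulrAC mulVf// mul1r powR_le// ltW//.
Qed.

(** Subgradient inequalities at both endpoints squeeze the remainder between 0 and the pairing of
    the gradient change with [h]. The summand 1 keeps [C] positive even for [d = 0]. *)
Let F_taylor x : exists C, 0 < C /\
  forall h, 0 <= F (h + x) - F x - inner (theta *: G x) h <= C * `|h| ^+ 2.
Proof.
pose c := d%:R `^ p^-1; have c0 : 0 <= c by exact: powR_ge0.
have th := hoelder_scale_gt0.
exists (theta * Lam * c ^+ 2 + 1); split.
  exact: ltr_wpDl (mulr_ge0 (ltW (mulr_gt0 th Lam_gt0)) (exprn_ge0 2 c0)) ltr01.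
move=> h; have s1 := F_subgradient x (h + x); have s2 := F_subgradient (h + x) x.
rewrite addrK in s1; rewrite opprD addrA addrAC subrr add0r linearN/= in s2.
rewrite subr_ge0 lerBrDl s1/=.
have l := lipschitz x (h + x) h; rewrite addrK -mulrA -expr2 innerBl in l.
have hc : lpnorm p h <= c * `|h| by exact: lpnorm_le_norm.
have hc2 : lpnorm p h ^+ 2 <= c ^+ 2 * `|h| ^+ 2.
  by rewrite -exprMn ler_pXn2r// nnegrE ?lpnorm_ge0// mulr_ge0.
rewrite !innerZl in s1 s2 *.
have l2 := ler_wpM2l (ltW th) (le_trans l (ler_wpM2l (ltW Lam_gt0) hc2)).
rewrite mulrDl mul1r; have := sqr_ge0 `|h|.
move: l2; rewrite mulrBr (mulrA Lam) 2!(mulrA theta); move: s2.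
move: (theta * inner _ h) (theta * inner _ h) (theta * f _) (theta * f _) => a b u v.
move: (`|h| ^+ 2) (theta * Lam * c ^+ 2 * _) => w z; lra.
Qed.

Let F_differential x : differentiable F x /\
  'd F x = inner (theta *: G x) :> (E -> R).
Proof.
have dF : F \o shift x = cst (F x) + inner (theta *: G x) +o_ 0 id.
  apply/eqaddoP => e e0; have [C [C0 FC]] := F_taylor x.
  have small := @nbhs0_lt R E _ (divr_gt0 e0 C0).
  apply: filterS small => h hlt.
  have /andP[h1 h2] := FC h.
  rewrite -[X in `|X|]/(F (h + x) - (F x + inner (theta *: G x) h)).
  rewrite opprD addrA ger0_norm//; apply: (le_trans h2).
  by rewrite expr2 mulrA ler_wpM2r// mulrC -ler_pdivlMr// ltW.
have dE := diff_unique (@inner_continuous _ _ (theta *: G x)) dF.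
split=> //; apply/diff_locallyP; rewrite dE; split=> //.
exact: inner_continuous.
Qed.

Let F_convex : convex_function [set: E] F.
Proof.
move=> t x y _ _; rewrite convRE.
set z : E := conv t x y.
have zE : z = t%:num *: x + (1 - t%:num) *: y by [].
have := F_subgradient z x; have := F_subgradient z y.
have t0 : 0 <= t%:num by [].
have t1 : t%:num <= 1 by [].
have -> : y - z = t%:num *: (y - x).
  by apply/rowP => i; rewrite zE !mxE; ring.
have -> : x - z = - ((1 - t%:num) *: (y - x)).
  by apply/rowP => i; rewrite zE !mxE; ring.
rewrite linearN !linearZ/=; move: (inner _ (y - x)) => u.
rewrite /GRing.scale/=; move: (theta * f z) (theta * f x) (theta * f y) => a b c.
rewrite /unstable.onem; move: t0 t1; move: (t%:num) => s s0 s1 h1 h2.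
have s1' : 0 <= 1 - s by rewrite subr_ge0.
have := ler_wpM2l s0 h2; have := ler_wpM2l s1' h1; lra.
Qed.

Lemma hoelder_scale_smooth_class : smooth_class p kappa 1 F.
Proof.
split; first exact: F_convex.
have [k0|k0] := eqVneq kappa 0.
  (* The class constrains every subgradient, not only [G]. Comparison with the slope at [h + x]
     gives each a dual norm of at most one half. *)
  have le x g h : subdifferential F x g -> inner g h <= 2^-1 * lpnorm p h.
    move=> /(_ (h + x)); rewrite addrK => g1.
    have := F_subgradient (h + x) x.
    rewrite opprD addrA addrAC subrr add0r linearN/= innerZl => g2.
    have := ler_wpM2l (ltW hoelder_scale_gt0) (bounded (h + x) h).
    have thE : theta = 2^-1 by rewrite /theta k0 powRr0 mulr1.
    by rewrite thE in g1 g2 *; move: g1 g2; lra.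
  move=> x y gx gy gxF gyF; apply: lpnorm_conj_exp_le => // h.
  rewrite mul1r innerBl.
  have := le _ _ h gxF; have := le _ _ (- h) gyF; rewrite lpnormN linearN/=; lra.
have gradE x : gradient F x = theta *: G x.
  apply/rowP => i; rewrite mxE; have [dF dE] := F_differential x.
  by rewrite deriveE// dE inner_delta.
split=> [x|x y]; first by have [] := F_differential x.
rewrite !gradE mul1r; apply: lpnorm_conj_exp_le => [//||h].
  exact: powR_ge0.
exact: F_hoelder.
Qed.

End membership.

(** * Soft maximum of convex functions with controlled slopes *)

Section softmax_composition.
Context {R : realType} {d : nat} {T : finType} (t0 : T) (eta s : R).
Local Notation E := 'rV[R]_d.
Hypotheses (eta_gt0 : 0 < eta) (s_ge1 : 1 <= s).
Variables (v : E -> T -> R) (D : T -> E -> E) (B : T -> E -> R) (p C : R).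
Hypothesis v_subgradient : forall k x y,
  v x k + inner (D k x) (y - x) <= v y k.
Hypothesis v_lipschitz : forall k x y, `|v y k - v x k| <= B k (y - x).
Hypothesis D_bounded : forall k x h, `|inner (D k x) h| <= B k h.
Hypothesis D_lipschitz : forall k x y h,
  inner (D k y - D k x) h <= B k (y - x) * B k h.
Hypothesis B_le : forall k h, B k h <= lpnorm p h.
Hypothesis C_ge0 : 0 <= C.
Hypothesis B_weighted : forall (m : T -> R) h, (forall k, 0 <= m k) ->
  \sum_k m k <= 2 ->
  \sum_k m k `^ (1 - s^-1) * B k h ^+ 2 <= C * lpnorm p h ^+ 2.

Local Notation lambda := (softmax_weight t0 eta_gt0 s_ge1).

Definition softmax_comp x : R := softmax t0 eta_gt0 s_ge1 (v x).
Definition softmax_grad x : E := \sum_k lambda (v x) k *: D k x.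

Let B_ge0 k h : 0 <= B k h.
Proof. exact: le_trans (normr_ge0 _) (D_bounded k 0 h). Qed.

Let inner_grad x h :
  inner (softmax_grad x) h = \sum_k lambda (v x) k * inner (D k x) h.
Proof.
rewrite /softmax_grad.
have inner0l : inner (0 : E) h = 0.
  by rewrite /inner big1// => i _; rewrite mxE mul0r.
rewrite (big_morph (fun g : E => inner g h) (fun g g' => innerDl g g' h) inner0l).
by apply: eq_bigr => k _; rewrite innerZl.
Qed.

Lemma softmax_comp_subgradient x y :
  softmax_comp x + inner (softmax_grad x) (y - x) <= softmax_comp y.
Proof.
apply: le_trans (softmax_subgradient t0 eta_gt0 s_ge1 (v x) (v y)).
rewrite lerD2l inner_grad ler_sum// => k _.
by rewrite ler_wpM2l ?softmax_weight_ge0// lerBrDl v_subgradient.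
Qed.

Lemma softmax_grad_bounded x h : inner (softmax_grad x) h <= lpnorm p h.
Proof.
rewrite inner_grad -[leRHS]mul1r -[X in X * _](softmax_weight_sum t0 eta_gt0 s_ge1 (v x)).
rewrite mulr_suml ler_sum// => k _; rewrite ler_wpM2l ?softmax_weight_ge0//.
exact: le_trans (le_trans (ler_norm _) (D_bounded _ _ _)) (B_le _ _).
Qed.

(** Product rule: the change of weights gives [s / eta * C], the change of slopes gives 1. The mass
    bound 2 in [B_weighted] is that of the maximum of two weight vectors. *)
Lemma softmax_grad_lipschitz x y h :
  inner (softmax_grad y - softmax_grad x) h <=
  (s / eta * C + 1) * lpnorm p (y - x) * lpnorm p h.
Proof.
have -> : inner (softmax_grad y - softmax_grad x) h =
    \sum_k (lambda (v y) k - lambda (v x) k) * inner (D k y) h +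
    \sum_k lambda (v x) k * inner (D k y - D k x) h.
  rewrite innerBl !inner_grad -sumrB -big_split/=; apply: eq_bigr => k _.
  by rewrite innerBl mulrBl mulrBr addrA subrK.
have m0 k : 0 <= Num.max (lambda (v y) k) (lambda (v x) k).
  by rewrite le_max softmax_weight_ge0.
have m2 : \sum_k Num.max (lambda (v y) k) (lambda (v x) k) <= 2.
  have -> : 2 = \sum_k (lambda (v y) k + lambda (v x) k).
    by rewrite big_split/= !softmax_weight_sum.
  apply: ler_sum => k _; rewrite ge_max lerDl lerDr.
  by rewrite !softmax_weight_ge0.
have h1 := softmax_weight_lipschitz
  (fun k => v_lipschitz k x y) C_ge0 (lpnorm_ge0 p (y - x)) (lpnorm_ge0 p h)
  (B_weighted (y - x) m0 m2) (B_weighted h m0 m2).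
have h2 : \sum_k (lambda (v y) k - lambda (v x) k) * inner (D k y) h <=
    s / eta * C * lpnorm p (y - x) * lpnorm p h.
  apply: le_trans h1; apply: ler_sum => k _; apply: (le_trans (ler_norm _)).
  by rewrite normrM ler_wpM2l.
have h3 : \sum_k lambda (v x) k * inner (D k y - D k x) h <=
    lpnorm p (y - x) * lpnorm p h.
  rewrite -[leRHS]mul1r -[X in X * _](softmax_weight_sum t0 eta_gt0 s_ge1 (v x)).
  rewrite mulr_suml ler_sum// => k _; rewrite ler_wpM2l ?softmax_weight_ge0//.
  by apply: (le_trans (D_lipschitz _ _ _ _)); exact: ler_pM.
by apply: (le_trans (lerD h2 h3)); rewrite !mulrDl mul1r.
Qed.

End softmax_composition.

(** * The hard functions *)

Section blocks.
Context {R : realType} {d n : nat} (L : nat) (blk : 'I_d -> nat) (p : R).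
Local Notation E := 'rV[R]_d.
Hypotheses (p_ge2 : 2 <= p) (L_gt0 : (0 < L)%N).
Hypothesis card_blk : forall i : 'I_n, #|[pred j | blk j == i]| = L.
Implicit Types (i : 'I_n) (x y h rho : E).

Let p_gt0 : 0 < p. Proof. exact: lt_le_trans p_ge2. Qed.
Let L_gt0R : 0 < L%:R :> R. Proof. by rewrite ltr0n. Qed.

(** The exponent gives block norm 1 to a block with all entries of modulus [L ^ (- 1 / p)], whose
    l_p norm is also 1. *)
Definition blk_scale : R := L%:R `^ (2 / p - 1).

Definition blk_dual i x : E :=
  \row_j (if blk j == i then blk_scale * x 0 j else 0).

Definition blk_inner i x y : R := inner (blk_dual i x) y.

(* Equals [L `^ (1 / p)] times the root mean square of the block; the scaling
   makes it at most the l_p norm of the block. *)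
Definition blk_norm i x : R := Num.sqrt (blk_inner i x x).

Definition blk_wall i x : R := Num.sqrt (1 + blk_inner i x x).

Lemma blk_scale_gt0 : 0 < blk_scale. Proof. exact: powR_gt0. Qed.

Lemma blk_innerE i x y :
  blk_inner i x y = blk_scale * \sum_(j | blk j == i) x 0 j * y 0 j.
Proof.
rewrite /blk_inner /inner mulr_sumr [RHS]big_mkcond; apply: eq_bigr => j _.
by rewrite mxE; case: ifP; rewrite ?mul0r// mulrA.
Qed.

Lemma blk_innerC i x y : blk_inner i x y = blk_inner i y x.
Proof. by rewrite !blk_innerE; congr (_ * _); apply: eq_bigr => j _; rewrite mulrC. Qed.

Lemma blk_innerBr i x y h :
  blk_inner i x (y - h) = blk_inner i x y - blk_inner i x h.
Proof. exact: linearB. Qed.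

Lemma blk_innerZr i x (a : R) y : blk_inner i x (a *: y) = a * blk_inner i x y.
Proof. exact: linearZ. Qed.

Lemma blk_inner_ge0 i x : 0 <= blk_inner i x x.
Proof.
rewrite blk_innerE mulr_ge0 ?(ltW blk_scale_gt0)// sumr_ge0// => j _.
by rewrite -expr2 sqr_ge0.
Qed.

Lemma blk_inner_subsub i x y : blk_inner i (x - y) (x - y) =
  blk_inner i x x - 2 * blk_inner i x y + blk_inner i y y.
Proof.
rewrite blk_innerBr !(blk_innerC i (x - y)) !blk_innerBr (blk_innerC i y x); ring.
Qed.

Lemma blk_inner_sqr_le i x y :
  blk_inner i x y ^+ 2 <= blk_inner i x x * blk_inner i y y.
Proof.
apply: sum_cauchy_schwarz => j; rewrite !mxE; case: ifP => _; rewrite ?mul0r//.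
- by rewrite -mulrA mulr_ge0 ?(ltW blk_scale_gt0)// -expr2 sqr_ge0.
- by rewrite -mulrA mulr_ge0 ?(ltW blk_scale_gt0)// -expr2 sqr_ge0.
- by rewrite le_eqVlt; apply/orP; left; apply/eqP; ring.
- by rewrite expr0n.
Qed.

Lemma blk_norm_ge0 i x : 0 <= blk_norm i x. Proof. exact: sqrtr_ge0. Qed.

Lemma blk_norm_sqr i x : blk_norm i x ^+ 2 = blk_inner i x x.
Proof. by rewrite sqr_sqrtr// blk_inner_ge0. Qed.

Lemma norm_blk_inner_le i x y :
  `|blk_inner i x y| <= blk_norm i x * blk_norm i y.
Proof.
rewrite -ler_sqr ?nnegrE ?mulr_ge0 ?blk_norm_ge0// exprMn !blk_norm_sqr.
by rewrite real_normK ?num_real// blk_inner_sqr_le.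
Qed.

Lemma blk_wall_sqr i x : blk_wall i x ^+ 2 = 1 + blk_inner i x x.
Proof. by rewrite sqr_sqrtr// addr_ge0// blk_inner_ge0. Qed.

Lemma blk_wall_ge1 i x : 1 <= blk_wall i x.
Proof.
rewrite -ler_sqr ?nnegrE ?sqrtr_ge0// blk_wall_sqr expr1n lerDl.
exact: blk_inner_ge0.
Qed.

Lemma blk_wall_ge_norm i x : blk_norm i x <= blk_wall i x.
Proof. by rewrite ler_wsqrtr// lerDr. Qed.

(** Cauchy-Schwarz for the vectors (1, x) and (1, y); all later wall estimates come from it. *)
Lemma blk_wall_mul_ge i x y : 1 + blk_inner i x y <= blk_wall i x * blk_wall i y.
Proof.
apply: (le_trans (ler_norm _)).
rewrite -ler_sqr ?nnegrE ?mulr_ge0 ?sqrtr_ge0// exprMn !blk_wall_sqr.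
rewrite real_normK ?num_real//.
have := blk_inner_sqr_le i x y; have := blk_inner_ge0 i (x - y).
rewrite blk_inner_subsub; move: (blk_inner i x x) (blk_inner i x y).
by move: (blk_inner i y y) => a b c; lra.
Qed.

Lemma blk_wall_subgradient i x y :
  blk_wall i x + (blk_wall i x)^-1 * blk_inner i x (y - x) <= blk_wall i y.
Proof.
have P0 : 0 < blk_wall i x by rewrite (lt_le_trans _ (blk_wall_ge1 i x)).
rewrite -(ler_pM2l P0) mulrDr mulrA divff ?gt_eqF// mul1r -expr2 blk_wall_sqr.
apply: le_trans (blk_wall_mul_ge i x y).
by rewrite blk_innerBr -addrA lerD2l addrC subrK.
Qed.

Lemma blk_wall_lipschitz i x y :
  `|blk_wall i y - blk_wall i x| <= blk_norm i (y - x).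
Proof.
rewrite -ler_sqr ?nnegrE ?blk_norm_ge0// real_normK ?num_real// blk_norm_sqr.
rewrite blk_inner_subsub sqrrB !blk_wall_sqr.
have := blk_wall_mul_ge i y x; rewrite -mulr_natl.
move: (blk_wall i y * blk_wall i x) => w; lra.
Qed.

(* [blk_wall i x] is the length of the vector (1, x), and normalizing vectors
   of length at least 1 does not increase their distance. *)
Lemma blk_wall_grad_lipschitz i x y :
  blk_norm i ((blk_wall i y)^-1 *: y - (blk_wall i x)^-1 *: x)
    <= blk_norm i (y - x).
Proof.
rewrite ler_wsqrtr// !blk_inner_subsub !blk_innerZr !(blk_innerC i (_ *: _)).
rewrite !blk_innerZr.
have := blk_wall_mul_ge i y x; have := blk_wall_sqr i y; have := blk_wall_sqr i x.
have := blk_wall_ge1 i x; have := blk_wall_ge1 i y.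
rewrite (blk_innerC i x y); move: (blk_wall i x) (blk_wall i y) => P Q.
move: (blk_inner i x x) (blk_inner i y y) (blk_inner i y x) => a b c.
move=> Q1 P1 aE bE cPQ.
have {aE}-> : a = P ^+ 2 - 1 by rewrite aE addrC addKr.
have {bE}-> : b = Q ^+ 2 - 1 by rewrite bE addrC addKr.
have P0 : P != 0 by rewrite gt_eqF// (lt_le_trans ltr01).
have Q0 : Q != 0 by rewrite gt_eqF// (lt_le_trans ltr01).
rewrite -subr_ge0.
have -> : Q ^+ 2 - 1 - 2 * c + (P ^+ 2 - 1) -
    (Q^-1 * (Q^-1 * (Q ^+ 2 - 1)) - 2 * (P^-1 * (Q^-1 * c)) +
     P^-1 * (P^-1 * (P ^+ 2 - 1))) =
    (P - Q) ^+ 2 + (P^-1 - Q^-1) ^+ 2 +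
    2 * ((Q * P - (1 + c)) * (1 - Q^-1 * P^-1)).
  by field; rewrite P0 Q0.
rewrite addr_ge0 ?addr_ge0 ?sqr_ge0// mulr_ge0// mulr_ge0 ?subr_ge0//.
by rewrite -invfM invf_le1 ?mulr_gt0 ?(lt_le_trans ltr01)// mulr_ege1.
Qed.

(** Power mean inequality: tangents of the power [p / 2] at the mean square [A], summed over the
    block, have cancelling first-order terms. *)
Lemma blk_norm_powR_le i h :
  blk_norm i h `^ p <= \sum_(j | blk j == i) `|h 0 j| `^ p.
Proof.
set A := (\sum_(j | blk j == i) h 0 j ^+ 2) / L%:R.
have A0 : 0 <= A.
  by rewrite divr_ge0 ?ler0n// sumr_ge0// => j _; exact: sqr_ge0.
have s1 : 1 <= p / 2 by rewrite ler_pdivlMr// mul1r.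
have -> : blk_norm i h `^ p = L%:R * A `^ (p / 2).
  rewrite /blk_norm -powR12_sqrt ?blk_inner_ge0// -powRrM mulrC blk_innerE.
  have -> : \sum_(j | blk j == i) h 0 j * h 0 j = L%:R * A.
    by rewrite mulrC divfK ?gt_eqF//; apply: eq_bigr => j _; rewrite expr2.
  have scaleL : blk_scale * L%:R = L%:R `^ (2 / p).
    rewrite /blk_scale powRB ?(gt_eqF L_gt0R) ?implybT// (powRr1 (ltW L_gt0R)).
    by rewrite divfK ?gt_eqF.
  rewrite (mulrA blk_scale) scaleL (powRM _ (powR_ge0 _ _) A0) -powRrM.
  have -> : 2 / p * (p / 2) = 1 by field; rewrite gt_eqF.
  by rewrite (powRr1 (ltW L_gt0R)).
have tg (j : 'I_d) : p / 2 * A `^ (p / 2 - 1) * h 0 j ^+ 2 <=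
    (p / 2 - 1) * A `^ (p / 2) + `|h 0 j| `^ p.
  have -> : `|h 0 j| `^ p = (h 0 j ^+ 2) `^ (p / 2).
    rewrite -(real_normK (num_real (h 0 j))) -powR_mulrn// -powRrM.
    by congr (_ `^ _); rewrite mulrC divfK.
  exact: powR_tangent (sqr_ge0 _) s1.
have : \sum_(j | blk j == i) p / 2 * A `^ (p / 2 - 1) * h 0 j ^+ 2 <=
    \sum_(j | blk j == i) ((p / 2 - 1) * A `^ (p / 2) + `|h 0 j| `^ p).
  exact: ler_sum.
rewrite big_split/= sumr_const card_blk -mulr_sumr.
have -> : \sum_(j | blk j == i) h 0 j ^+ 2 = L%:R * A.
  by rewrite mulrC divfK ?gt_eqF.
have -> : p / 2 * A `^ (p / 2 - 1) * (L%:R * A) =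
    p / 2 * L%:R * (A * A `^ (p / 2 - 1)) by ring.
rewrite (mulr_powRB1 A0 (lt_le_trans ltr01 s1)) -[_ *+ L]mulr_natl.
by move: (\sum_(j | _) _) (A `^ (p / 2)) => u w; lra.
Qed.

Lemma sum_blk_norm_powR_le h : \sum_(i < n) blk_norm i h `^ p <= lpnorm p h `^ p.
Proof.
rewrite lpnorm_powR//.
apply: (@le_trans _ _ (\sum_(i < n) \sum_(j | blk j == i) `|h 0 j| `^ p)).
  by apply: ler_sum => i _; exact: blk_norm_powR_le.
rewrite (eq_bigr (fun i : 'I_n =>
  \sum_j (if blk j == i then `|h 0 j| `^ p else 0))); last first.
  by move=> i _; rewrite big_mkcond.
rewrite exchange_big/= ler_sum// => j _.
have [jn|nj] := ltnP (blk j) n.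
  rewrite (bigD1 (Ordinal jn))//= eqxx big1 ?addr0// => i.
  by move=> /eqP ne; case: eqP => // e; case: ne; exact/val_inj.
rewrite big1 ?powR_ge0// => i _; case: eqP => // e.
by have := ltn_ord i; rewrite -e ltnNge nj.
Qed.

Lemma blk_norm_le i h : blk_norm i h <= lpnorm p h.
Proof.
have := sum_blk_norm_powR_le h; rewrite (bigD1 i)//= => le.
have {}le : blk_norm i h `^ p <= lpnorm p h `^ p.
  apply: le_trans le; rewrite lerDl sumr_ge0// => k _; exact: powR_ge0.
rewrite leNgt; apply/negP => lt.
have := @gt0_ltr_powR R p p_gt0 (lpnorm p h) (blk_norm i h).
by rewrite !nnegrE lpnorm_ge0 blk_norm_ge0 lt ltNge le => /(_ isT isT isT).
Qed.

Lemma sum_powR_weighted_le (T : finType) (m a : T -> R) (theta : R) :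
  0 < theta <= 1 -> (forall k, 0 <= m k) -> (forall k, 0 <= a k) ->
  \sum_k m k <= 2 -> \sum_k a k <= 2 ->
  \sum_k m k `^ (1 - theta) * a k `^ theta <= 2.
Proof.
move=> /andP[th0 th1] m0 a0 m2 a2.
apply: (@le_trans _ _ (\sum_k ((1 - theta) * m k + theta * a k))).
  by apply: ler_sum => k _; rewrite powR_AMGM// (ltW th0).
rewrite big_split/= -!mulr_sumr.
have h1 : (1 - theta) * (\sum_k m k) <= (1 - theta) * 2.
  by rewrite ler_wpM2l// subr_ge0.
have h2 : theta * (\sum_k a k) <= theta * 2 by rewrite ler_wpM2l// ltW.
by apply: le_trans (lerD h1 h2) _; rewrite -mulrDl subrK mul1r.
Qed.

Let half (k : 'I_n + 'I_n) : 'I_n := match k with inl i => i | inr i => i end.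

Let sum_half (F : 'I_n -> R) : \sum_k F (half k) = 2 * \sum_i F i.
Proof. by rewrite big_sumType/= mulrDl mul1r. Qed.

(* The second alternative is the case [p > ln d], where the l_p norm is replaced
   by the sup norm over the blocks at the cost of the factor [n `^ s^-1]. *)
Lemma blk_norm_weighted_le (s : R) (m : 'I_n + 'I_n -> R) h :
  1 <= s -> s = p / 2 \/ n%:R `^ s^-1 <= 3 ->
  (forall k, 0 <= m k) -> \sum_k m k <= 2 ->
  \sum_k m k `^ (1 - s^-1) * blk_norm (half k) h ^+ 2 <= 6 * lpnorm p h ^+ 2.
Proof.
move=> s1 sE m0 m2; set N := lpnorm p h.
have s0 : 0 < s by exact: lt_le_trans s1.
have th : 0 < s^-1 <= 1 by rewrite invr_gt0 s0 invf_le1.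
have N0 : 0 <= N by exact: lpnorm_ge0.
have bN k : blk_norm (half k) h ^+ 2 <= N ^+ 2.
  by rewrite ler_sqr ?nnegrE ?blk_norm_ge0// blk_norm_le.
move: (N0); rewrite le_eqVlt => /predU1P[NE|Np].
  rewrite -NE expr0n mulr0 big1// => k _.
  suff -> : blk_norm (half k) h ^+ 2 = 0 by rewrite mulr0.
  by apply/le_anti; rewrite sqr_ge0 (le_trans (bN k))// -NE expr0n.
have [sp|n3] := sE.
  (* With [1 / s = 2 / p], Hoelder against normalized p-th powers returns the squared block norms.
     Each block occurs twice among the indices, hence mass 2. *)
  pose a k := (blk_norm (half k) h / N) `^ p.
  have Npp : 0 < N `^ p by rewrite powR_gt0.
  have a2 : \sum_k a k <= 2.
    have aE k : a k = blk_norm (half k) h `^ p / N `^ p.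
      by rewrite /a powR_div ?blk_norm_ge0.
    rewrite (eq_bigr _ (fun k _ => aE k)) -mulr_suml.
    rewrite (sum_half (fun i => blk_norm i h `^ p)) ler_pdivrMr//.
    by rewrite ler_wpM2l// sum_blk_norm_powR_le.
  have a0 k : 0 <= a k by exact: powR_ge0.
  have := sum_powR_weighted_le th m0 a0 m2 a2.
  have aE k : a k `^ s^-1 = blk_norm (half k) h ^+ 2 / N ^+ 2.
    rewrite /a -powRrM sp; have -> : p * (p / 2)^-1 = 2 by field; rewrite gt_eqF.
    by rewrite powR_mulrn ?divr_ge0 ?blk_norm_ge0// expr_div_n.
  under eq_bigr do rewrite aE mulrA.
  rewrite -mulr_suml ler_pdivrMr ?exprn_gt0// => /le_trans; apply.
  by rewrite ler_wpM2r ?sqr_ge0// ler_nat.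
apply: (@le_trans _ _ (\sum_k m k `^ (1 - s^-1) * N ^+ 2)).
  by apply: ler_sum => k _; rewrite ler_wpM2l ?powR_ge0.
rewrite -mulr_suml ler_wpM2r ?sqr_ge0//.
have [n0|n0] := posnP n.
  by rewrite big1 ?ler0n// => -[] i; have := ltn_ord i; rewrite {2}n0.
have n0R : 0 < n%:R :> R by rewrite ltr0n.
(* The same inequality with constant second vector bounds the sum of [m ^ (1 - 1 / s)] by
   [2 n ^ (1 / s) <= 6], the origin of the constant 6. *)
have a2 : \sum_(k : 'I_n + 'I_n) n%:R^-1 <= 2 :> R.
  rewrite (sum_half (fun=> n%:R^-1)) sumr_const card_ord -[_ *+ n]mulr_natl.
  by rewrite divff ?gt_eqF// mulr1.
have inv0 (k : 'I_n + 'I_n) : 0 <= n%:R^-1 :> R by rewrite invr_ge0 ltW.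
have := sum_powR_weighted_le th m0 inv0 m2 a2.
have np0 : 0 < n%:R `^ s^-1 by rewrite powR_gt0.
have -> : n%:R^-1 `^ s^-1 = (n%:R `^ s^-1)^-1.
  by rewrite -[n%:R^-1]mul1r powR_div ?(ltW n0R)// powR1 mul1r.
rewrite -mulr_suml ler_pdivrMr// => /le_trans; apply.
by rewrite -[leRHS](_ : 2 * 3 = 6) ?ler_wpM2l// -natrM.
Qed.

(** * The hard function and what a quiet query sees *)

Section hard_function.
Variables (t0 : 'I_n) (eta s delta : R).
Hypotheses (eta_gt0 : 0 < eta) (s_ge1 : 1 <= s) (delta_ge0 : 0 <= delta).
Hypothesis s_or : s = p / 2 \/ n%:R `^ s^-1 <= 3.

(** With the offset 5/2 a wall entry is at most -1 at the comparison point, where the wall is at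
    most 3/2, yet above 1/2 once the block norm exceeds 3. *)
Definition hard_entries rho x (k : 'I_n + 'I_n) : R :=
  match k with
  | inl i => blk_inner i rho x - i%:R * delta
  | inr i => blk_wall i x - 5 / 2
  end.

Definition hard rho : E -> R :=
  softmax_comp (inl t0) eta_gt0 s_ge1 (hard_entries rho).

Let hard_slopes rho (k : 'I_n + 'I_n) x : E :=
  match k with
  | inl i => blk_dual i rho
  | inr i => (blk_wall i x)^-1 *: blk_dual i x
  end.

Let hard_grad rho := softmax_grad (inl t0) eta_gt0 s_ge1 (hard_entries rho)
  (hard_slopes rho).

Let entries_subgradient rho k x y :
  hard_entries rho x k + inner (hard_slopes rho k x) (y - x) <= hard_entries rho y k.
Proof.
case: k => i /=.
  by rewrite -/(blk_inner _ _ _) blk_innerBr addrAC lerD2r addrC subrK.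
by rewrite innerZl addrAC lerD2r; exact: blk_wall_subgradient.
Qed.

Let entries_lipschitz rho k x y : (forall i, blk_norm i rho <= 1) ->
  `|hard_entries rho y k - hard_entries rho x k| <= blk_norm (half k) (y - x).
Proof.
move=> rho_le1; case: k => i /=; rewrite opprD opprK addrACA ?addNr ?subrr addr0.
  rewrite -blk_innerBr (le_trans (norm_blk_inner_le _ _ _))//.
  by rewrite ler_piMl ?blk_norm_ge0.
exact: blk_wall_lipschitz.
Qed.

Let slopes_bounded rho k x h : (forall i, blk_norm i rho <= 1) ->
  `|inner (hard_slopes rho k x) h| <= blk_norm (half k) h.
Proof.
move=> rho_le1; case: k => i /=.
  rewrite -/(blk_inner _ _ _) (le_trans (norm_blk_inner_le _ _ _))//.
  by rewrite ler_piMl ?blk_norm_ge0.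
have w0 : 0 < blk_wall i x by rewrite (lt_le_trans _ (blk_wall_ge1 i x)).
rewrite innerZl normrM gtr0_norm ?invr_gt0// ler_pdivrMl//.
rewrite (le_trans (norm_blk_inner_le _ _ _))// ler_wpM2r ?blk_norm_ge0//.
exact: blk_wall_ge_norm.
Qed.

Let slopes_lipschitz rho k x y h :
  inner (hard_slopes rho k y - hard_slopes rho k x) h <=
  blk_norm (half k) (y - x) * blk_norm (half k) h.
Proof.
case: k => i /=.
  by rewrite subrr /inner big1 ?mulr_ge0 ?blk_norm_ge0// => j _; rewrite mxE mul0r.
have -> : (blk_wall i y)^-1 *: blk_dual i y - (blk_wall i x)^-1 *: blk_dual i x =
    blk_dual i ((blk_wall i y)^-1 *: y - (blk_wall i x)^-1 *: x).
  by apply/rowP => j; rewrite !mxE; case: ifP => _; ring.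
apply: (le_trans (ler_norm _)); apply: (le_trans (norm_blk_inner_le _ _ _)).
by rewrite ler_wpM2r ?blk_norm_ge0// blk_wall_grad_lipschitz.
Qed.

Lemma hard_smooth_class rho (kappa Lam : R) :
  (forall i, blk_norm i rho <= 1) -> 0 <= kappa <= 1 -> s / eta * 6 + 1 <= Lam ->
  smooth_class p kappa 1 (fun x => hoelder_scale kappa Lam * hard rho x).
Proof.
move=> rho_le1 k01 sL; have Lam0 : 0 < Lam.
  apply: lt_le_trans sL; rewrite ltr_wpDl// mulr_ge0// divr_ge0 ?(ltW eta_gt0)//.
  exact: le_trans s_ge1.
apply: (@hoelder_scale_smooth_class _ _ _ _ _ _ (hard_grad rho)) => //.
- by rewrite (lt_le_trans _ p_ge2)// ltr1n.
- move=> x y; exact: softmax_comp_subgradient.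
- move=> x h; apply: softmax_grad_bounded => //.
  + by move=> k {}x {}h; exact: slopes_bounded.
  + by move=> k {}h; exact: blk_norm_le.
- move=> x y h; apply: (@le_trans _ _
    ((s / eta * 6 + 1) * lpnorm p (y - x) * lpnorm p h)).
    apply: (@softmax_grad_lipschitz _ _ _ _ _ _ _ _ _ _
      (fun k => blk_norm (half k))) => //.
    + by move=> k {}x {}y; exact: entries_lipschitz.
    + by move=> k {}x {}h; exact: slopes_bounded.
    + by move=> k {}h; exact: blk_norm_le.
    + by move=> m {}h m0 m2; exact: blk_norm_weighted_le.
  rewrite -[leLHS]mulrA -[leRHS]mulrA ler_wpM2r//.
  by rewrite (mulr_ge0 (lpnorm_ge0 _ _) (lpnorm_ge0 _ _)).
Qed.

Definition blk_mask (t : nat) rho : E :=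
  \row_j (if (blk j <= t)%N then rho 0 j else 0).

Lemma blk_inner_mask t i rho x : blk_inner i (blk_mask t rho) x =
  if (i <= t)%N then blk_inner i rho x else 0.
Proof.
rewrite !blk_innerE; case: ifP => it.
  by congr (_ * _); apply: eq_bigr => j /eqP ji; rewrite mxE ji it.
by rewrite big1 ?mulr0// => j /eqP ji; rewrite mxE ji it mul0r.
Qed.

Lemma blk_norm_mask t i rho : blk_norm i rho <= 1 ->
  blk_norm i (blk_mask t rho) <= 1.
Proof.
move=> h; rewrite /blk_norm blk_inner_mask; case: ifP => it.
  by rewrite blk_innerC blk_inner_mask it.
by rewrite sqrtr0 ler01.
Qed.

(* At a quiet query of round [t], the entries of the blocks after [t] are not
   visible, and the value of [hard] is not small. *)
Definition quiet (a : R) (t : 'I_n) rho x : Prop :=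
  - (a * blk_norm t x) <= blk_inner t rho x /\
  forall i, (t < i)%N -> blk_inner i rho x <= a * blk_norm i x.

Lemma quiet_mask a t rho x : 0 <= a -> quiet a t rho x ->
  quiet a t (blk_mask t rho) x.
Proof.
move=> a0 [h1 h2]; split=> [|i ti]; rewrite blk_inner_mask ?leqnn//.
by rewrite leqNgt ti/= mulr_ge0 ?blk_norm_ge0.
Qed.

(** If both block norms are at most 3, quietness costs [3 a] for each of the two blocks and entry
    [t] dominates. Otherwise the wall of a large block does: [(1 - a) * 3] exceeds 5/2 since
    [a <= 1 / 16]. *)
Lemma quiet_dominated a t rho x i : 0 <= a <= 1 / 16 -> quiet a t rho x ->
  (t < i)%N -> exists l, hard_entries rho x (inl i) + (delta - 6 * a)
                         <= hard_entries rho x l.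
Proof.
move=> /andP[a0 a1] [h1 h2] ti; have {}h2 := h2 _ ti.
have di : (t%:R + 1) * delta <= i%:R * delta :> R.
  by rewrite ler_wpM2r// natr1 ler_nat.
have td : 0 <= t%:R * delta by rewrite mulr_ge0.
rewrite mulrDl mul1r in di.
have bi := blk_norm_ge0 i x; have bt := blk_norm_ge0 t x.
have wi := blk_wall_ge_norm i x; have wt := blk_wall_ge_norm t x.
have [bi3|bi3] := leP (blk_norm i x) 3; last first.
  exists (inr i) => /=; move: h2 bi3 wi di td a1 a0.
  move: (blk_inner i rho x) (blk_norm i x) (blk_wall i x) (i%:R * delta).
  by move: (t%:R * delta) => T u b w I; nra.
have ab : a * blk_norm i x <= a * 3 by rewrite ler_wpM2l.
have [bt3|bt3] := leP (blk_norm t x) 3.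
  exists (inl t) => /=; have abt : a * blk_norm t x <= a * 3 by rewrite ler_wpM2l.
  move: h1 h2 ab abt di; move: (blk_inner i rho x) (blk_inner t rho x).
  move: (a * blk_norm i x) (a * blk_norm t x) (i%:R * delta) (t%:R * delta).
  move=> A B I T u v; lra.
exists (inr t) => /=; move: h2 ab di td wt bt3 a0 a1.
move: (blk_inner i rho x) (a * blk_norm i x) (i%:R * delta) (t%:R * delta).
move: (blk_wall t x) (blk_norm t x) => w b u A I T; lra.
Qed.

Lemma hard_near_mask a t rho x : (forall i, blk_norm i rho <= 1) ->
  0 <= a <= 1 / 16 -> 6 * a + eta < delta -> quiet a t rho x ->
  \forall y \near x, hard rho y = hard (blk_mask t rho) y.
Proof.
move=> rho1 a01 gap q; have /andP[a0 _] := a01.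
set c := d%:R `^ p^-1; have c0 : 0 <= c by exact: powR_ge0.
(* Half of the slack in [gap]: two entries may each move by [g] and still differ by [eta]. *)
set g := (delta - 6 * a - eta) / 2; have g0 : 0 < g.
  by rewrite divr_gt0// subr_gt0 ltrBrDl.
have e0 : 0 < g / (c + 1) by rewrite divr_gt0// ltr_wpDl.
have := @nbhsx_ballx _ E x _ e0; apply: filterS => y.
rewrite -ball_normE/= => xy.
have close r k : (forall i, blk_norm i r <= 1) ->
    `|hard_entries r y k - hard_entries r x k| <= g.
  move=> r1; apply: (le_trans (entries_lipschitz _ _ _ r1)).
  apply: (le_trans (blk_norm_le _ _)); rewrite lpnormB.
  apply: (le_trans (lpnorm_le_norm _ p_gt0)); rewrite -/c.
  apply: (@le_trans _ _ ((c + 1) * `|x - y|)).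
    by rewrite ler_wpM2r// lerDl.
  by rewrite mulrC -ler_pdivlMr ?ltr_wpDl// ltW.
have hidden r i : (forall i, blk_norm i r <= 1) -> quiet a t r x -> (t < i)%N ->
    exists l, hard_entries r y (inl i) + eta <= hard_entries r y l.
  move=> r1 rq ti; have [l hl] := quiet_dominated a01 rq ti; exists l.
  have := close r (inl i) r1; have := close r l r1; move: hl.
  rewrite !ler_distl /g; move: (hard_entries r y l) (hard_entries r x l).
  move: (hard_entries r y (inl i)) (hard_entries r x (inl i)).
  move=> A B C D hl /andP[h1 h2] /andP[h3 h4].
  by move: gap hl h1 h2 h3 h4; lra.
apply: softmax_eq => -[i|i]; last by left.
have [it|ti] := leqP i t; first by left; rewrite /= blk_inner_mask it.
right; split; first exact: hidden.
by apply: hidden => //; [move=> k; exact: blk_norm_mask|exact: quiet_mask].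
Qed.

Lemma hard_quiet_ge a t rho x : 0 <= a -> quiet a t rho x ->
  - (3 * a + t%:R * delta + eta) <= hard rho x.
Proof.
move=> a0 [h1 _].
have td : 0 <= t%:R * delta by rewrite mulr_ge0.
have [bt3|bt3] := leP (blk_norm t x) 3.
  have := softmax_ge (inl t0) eta_gt0 s_ge1 (hard_entries rho x) (inl t).
  apply: le_trans => /=; have abt : a * blk_norm t x <= a * 3 by rewrite ler_wpM2l.
  move: h1 abt; move: (blk_inner t rho x) (a * _) (t%:R * delta) => u v w; lra.
have := softmax_ge (inl t0) eta_gt0 s_ge1 (hard_entries rho x) (inr t).
apply: le_trans => /=; have wt := blk_wall_ge_norm t x.
move: bt3 wt td a0; move: (blk_norm t x) (blk_wall t x) (t%:R * delta) => u v w.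
lra.
Qed.

Lemma hard_opp_le rho (c : R) : 0 <= c <= 1 ->
  (forall i, blk_inner i rho rho = 1) -> hard rho (- c *: rho) <= - c.
Proof.
move=> /andP[c0 c1] rho1; apply: softmax_le => -[i|i] /=.
  by rewrite blk_innerZr rho1 mulr1 gerBl mulr_ge0.
have : blk_wall i (- c *: rho) <= 3 / 2.
  rewrite /blk_wall blk_innerZr blk_innerC blk_innerZr rho1 mulr1 mulrNN -expr2.
  rewrite -ler_sqr ?nnegrE ?sqrtr_ge0// sqr_sqrtr ?addr_ge0 ?sqr_ge0//.
  have : c ^+ 2 <= 1 by rewrite expr_le1.
  by move: (c ^+ 2) => u; lra.
by move: (blk_wall _ _) => u; lra.
Qed.

End hard_function.

End blocks.

(** * Random signs *)

Section rademacher.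
Context {R : realType}.

(** Cruder than the optimal exponent [y ^ 2 / 2], but it needs only [1 + x <= expR x]; hence the 8
    in the tail bound below. *)
Lemma expR_add_opp_le (y : R) : expR y + expR (- y) <= 2 * expR (2 * y ^+ 2).
Proof.
have [y2|y2] := leP (y ^+ 2) (1 / 2).
  have ym : 0 < 1 - y by nra.
  have yp : 0 < 1 + y by nra.
  have e1 : expR y <= (1 - y)^-1.
    by rewrite -[y in expR y]opprK expRN lef_pV2 ?posrE ?expR_gt0// expR_ge1Dx.
  have e2 : expR (- y) <= (1 + y)^-1.
    by rewrite expRN lef_pV2 ?posrE ?expR_gt0// expR_ge1Dx.
  apply: (le_trans (lerD e1 e2)).
  apply: (@le_trans _ _ (2 * (1 + 2 * y ^+ 2))); last by rewrite ler_pM2l// expR_ge1Dx.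
  have -> : (1 - y)^-1 + (1 + y)^-1 = 2 / (1 - y ^+ 2).
    by field; rewrite !gt_eqF//; nra.
  have y0 := sqr_ge0 y; move: y2 y0; move: (y ^+ 2) => u u1 u0.
  by rewrite ler_pdivrMr; nra.
have le : y <= 2 * y ^+ 2 by nra.
have le' : - y <= 2 * y ^+ 2 by nra.
by rewrite mulrDl mul1r lerD// ler_expR.
Qed.

Lemma rademacher_tail (I : finType) (w : I -> R) (S u : R) :
  0 < S -> 0 < u -> \sum_i w i ^+ 2 <= S ->
  #|[pred z : {ffun I -> bool} | (u < \sum_i (-1) ^+ z i * w i)%R]|%:R
    <= 2 ^+ #|I| * expR (- (u ^+ 2 / (8 * S))).
Proof.
(* Chernoff: [th] minimizes the exponent [2 * th ^ 2 * S - th * u]. *)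
move=> S0 u0 wS; pose th := u / (4 * S).
have th0 : 0 < th by rewrite divr_gt0// mulr_gt0.
have mgf : \sum_(z : {ffun I -> bool}) expR (th * \sum_i (-1) ^+ z i * w i)
    <= 2 ^+ #|I| * expR (2 * th ^+ 2 * S).
  rewrite (eq_bigr (fun z : {ffun I -> bool} =>
      \prod_i expR (th * ((-1) ^+ z i * w i)))); last first.
    by move=> z _; rewrite mulr_sumr expR_sum.
  rewrite -(bigA_distr_bigA (fun i (b : bool) => expR (th * ((-1) ^+ b * w i)))).
  apply: (@le_trans _ _ (\prod_i (2 * expR (2 * (th * w i) ^+ 2)))).
    apply: ler_prod => i _; rewrite sumr_ge0 ?andTb => [|b _]; last exact: expR_ge0.
    rewrite big_bool/= expr1 expr0 mul1r mulN1r mulrN addrC.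
    exact: expR_add_opp_le.
  rewrite big_split/= prodr_const ler_pM2l ?exprn_gt0// -expR_sum ler_expR.
  rewrite (eq_bigr (fun i => 2 * th ^+ 2 * w i ^+ 2)); last first.
    by move=> i _; rewrite exprMn mulrA.
  by rewrite -mulr_sumr ler_wpM2l// mulr_ge0// sqr_ge0.
have markov : #|[pred z : {ffun I -> bool} | (u < \sum_i (-1) ^+ z i * w i)%R]|%:R *
    expR (th * u) <= \sum_(z : {ffun I -> bool}) expR (th * \sum_i (-1) ^+ z i * w i).
  rewrite -sum1_card natr_sum mulr_suml [leLHS]big_mkcond ler_sum// => z _.
  rewrite inE; case: ifP => [uz|_]; last exact: expR_ge0.
  by rewrite mul1r ler_expR ler_pM2l// ltW.
rewrite -(ler_pM2r (expR_gt0 (th * u))) (le_trans markov)// (le_trans mgf)//.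
rewrite -[leRHS]mulrA -expRD ler_pM2l ?exprn_gt0// ler_expR le_eqVlt.
by apply/orP; left; apply/eqP; rewrite /th; field; rewrite gt_eqF.
Qed.

(** Exchanging the coordinates in [J] between two independent copies is an involution on pairs. It
    turns the diagonal event into one whose two arguments are independent, and [z] can then be
    frozen. *)
Lemma resample_card (I : finType) (J : pred I)
    (P : {ffun I -> bool} -> {ffun I -> bool} -> bool) (c : R) :
  (forall z z' : {ffun I -> bool}, let y := [ffun i => if J i then z' i else z i] in
    P y y = P z z') ->
  (forall z, #|[pred z' | P z z']|%:R <= c) ->
  #|[pred z | P z z]|%:R <= c.
Proof.
move=> Pmix Pc; pose Z : finType := {ffun I -> bool}.
pose mix (zz : Z * Z) : Z * Z := ([ffun i => if J i then zz.2 i else zz.1 i],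
                                  [ffun i => if J i then zz.1 i else zz.2 i]).
have mixK : involutive mix.
  by case=> z z'; congr (_, _); apply/ffunP => i; rewrite !ffunE/= ?ffunE; case: (J i).
have Z0 : 0 < #|{: Z}|%:R :> R.
  by rewrite ltr0n; apply/card_gt0P; exists [ffun=> true].
have cardE (Q : pred Z) : #|[pred z | Q z]|%:R = \sum_z (Q z)%:R :> R.
  rewrite -sum1_card natr_sum big_mkcond; apply: eq_bigr => z _.
  by rewrite inE; case: ifP.
rewrite -(ler_pM2l Z0) (cardE (fun z => P z z)).
have -> : #|{: Z}|%:R * \sum_z (P z z)%:R =
    \sum_(zz : Z * Z) (P zz.1 zz.1)%:R :> R.
  rewrite -(pair_bigA _ (fun z _ => (P z z)%:R))/= mulr_sumr.
  by apply: eq_bigr => z _; rewrite sumr_const mulr_natl.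
rewrite (reindex_inj (inv_inj mixK))/=.
rewrite (eq_bigr (fun zz : Z * Z => (P zz.1 zz.2)%:R)); last first.
  by case=> z z' _; rewrite /= Pmix.
rewrite -(pair_bigA _ (fun z z' => (P z z')%:R))/=.
apply: (@le_trans _ _ (\sum_(z : Z) c)).
  by apply: ler_sum => z _; rewrite -(cardE (P z)).
by rewrite sumr_const mulr_natl.
Qed.

End rademacher.

Section random_signs.
Context {R : realType} {d n : nat} (L : nat) (blk : 'I_d -> nat) (p : R).
Local Notation E := 'rV[R]_d.
Hypotheses (p_ge2 : 2 <= p) (L_gt0 : (0 < L)%N).
Hypothesis card_blk : forall i : 'I_n, #|[pred j | blk j == i]| = L.
Implicit Types (i : 'I_n) (x : E) (z : {ffun 'I_d -> bool}).

Let p_gt0 : 0 < p. Proof. exact: lt_le_trans p_ge2. Qed.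
Let L_gt0R : 0 < L%:R :> R. Proof. by rewrite ltr0n. Qed.

(** Every block has l_p norm 1, so the factor [n ^ (- 1 / p)] brings the vector into the unit ball.
    Coordinates left over by the division into blocks are 0. *)
Definition sign_vec z : E :=
  \row_j (if (blk j < n)%N then (-1) ^+ z j * L%:R `^ (- p^-1) else 0).

Let scale_powR : blk_scale L p * (L%:R `^ (- p^-1)) ^+ 2 = L%:R^-1.
Proof.
rewrite -powR_mulrn ?powR_ge0// -powRrM -powRD ?(gt_eqF L_gt0R) ?implybT//.
have -> : 2 / p - 1 + - p^-1 * 2 = - 1 by ring.
by rewrite powR_inv1 ?(ltW L_gt0R).
Qed.

Lemma blk_inner_sign_vec i z : blk_inner L blk p i (sign_vec z) (sign_vec z) = 1.
Proof.
rewrite blk_innerE (eq_bigr (fun=> (L%:R `^ (- p^-1)) ^+ 2)); last first.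
  move=> j /eqP ji; rewrite mxE ji ltn_ord -expr2 exprMn.
  by rewrite sqrr_sign mul1r.
rewrite sumr_const card_blk -[_ *+ L]mulr_natl mulrCA scale_powR divff//.
by rewrite gt_eqF.
Qed.

Lemma blk_norm_sign_vec i z : blk_norm L blk p i (sign_vec z) = 1.
Proof. by rewrite /blk_norm blk_inner_sign_vec sqrtr1. Qed.

Lemma lpnorm_sign_vec_le z : lpnorm p (- (n%:R `^ (- p^-1)) *: sign_vec z) <= 1.
Proof.
have one : 1 `^ p^-1 = 1 :> R by rewrite powR1.
rewrite -[leRHS]one /lpnorm powR_le ?invr_ge0 ?(ltW p_gt0)//.
  by rewrite sumr_ge0// => j _; exact: powR_ge0.
have K0 : 0 <= (n%:R^-1 * L%:R^-1 : R) by rewrite mulr_ge0 ?invr_ge0 ?ler0n.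
apply: (@le_trans _ _
    (\sum_(j : 'I_d) \sum_(i < n) if blk j == i then n%:R^-1 * L%:R^-1 else 0)).
  apply: ler_sum => j _; rewrite !mxE; case: ifPn => jn; last first.
    by rewrite mulr0 normr0 powR0 ?gt_eqF// sumr_ge0// => i _; case: ifP.
  rewrite (bigD1 (Ordinal jn))//= eqxx big1 ?addr0; last first.
    by move=> i /eqP ne; case: eqP => // e; case: ne; exact/val_inj.
  rewrite normrM normrN normrM normrX normrN normr1 expr1n mul1r.
  rewrite !ger0_norm ?powR_ge0// powRM ?powR_ge0// -!powRrM mulNr mulVf ?gt_eqF//.
  by rewrite !powR_inv1 ?ler0n.
rewrite exchange_big/= (eq_bigr (fun i : 'I_n => n%:R^-1)); last first.
  move=> i _; rewrite -big_mkcond sumr_const card_blk -[_ *+ L]mulr_natr -mulrA.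
  by rewrite mulVf ?mulr1 ?gt_eqF.
rewrite sumr_const card_ord -[_ *+ n]mulr_natl.
by case: (posnP n) => [->|n0]; rewrite ?mul0r// divff// pnatr_eq0 gtn_eqF.
Qed.

Lemma sign_vec_tail (a : R) i x : 0 < a ->
  #|[pred z | a * blk_norm L blk p i x < blk_inner L blk p i (sign_vec z) x]|%:R
    <= 2 ^+ d * expR (- (a ^+ 2 * L%:R / 8)) :> R.
Proof.
move=> a0; set b := blk_norm L blk p i x.
have b_ge0 : 0 <= b by exact: blk_norm_ge0.
move: (b_ge0); rewrite le_eqVlt => /predU1P[bE|b0].
  rewrite eq_card0 ?mulr_ge0 ?expR_ge0 ?exprn_ge0// => z; rewrite inE -bE mulr0.
  apply/negbTE; rewrite -leNgt; apply: (le_trans (ler_norm _)).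
  by rewrite (le_trans (norm_blk_inner_le _ _ L_gt0 _ _ _))// -/b -bE mulr0.
pose w j := if blk j == i then blk_scale L p * L%:R `^ (- p^-1) * x 0 j else 0.
have inw z : blk_inner L blk p i (sign_vec z) x = \sum_j (-1) ^+ z j * w j.
  rewrite blk_innerE mulr_sumr big_mkcond; apply: eq_bigr => j _.
  rewrite /w mxE; case: eqP => [->|_]; last by rewrite mulr0.
  by rewrite ltn_ord; ring.
have wS : \sum_j w j ^+ 2 = b ^+ 2 / L%:R.
  have -> : b ^+ 2 = blk_inner L blk p i x x by rewrite /b blk_norm_sqr.
  rewrite blk_innerE -scale_powR mulrAC mulr_sumr.
  rewrite [RHS]big_mkcond; apply: eq_bigr => j _; rewrite /w.
  by case: ifP => _; [ring|rewrite expr0n].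
have := @rademacher_tail R 'I_d w (b ^+ 2 / L%:R) (a * b).
rewrite wS lexx card_ord divr_gt0 ?exprn_gt0// mulr_gt0// => /(_ isT isT isT).
have -> : (a * b) ^+ 2 / (8 * (b ^+ 2 / L%:R)) = a ^+ 2 * L%:R / 8.
  by field; rewrite !gt_eqF.
apply: le_trans; rewrite le_eqVlt; apply/orP; left; apply/eqP.
by congr _%:R; apply: eq_card => z; rewrite !inE inw.
Qed.

Lemma sign_vec_tail_adaptive (a : R) i (x : {ffun 'I_d -> bool} -> E) : 0 < a ->
  (forall z z', (forall j, (blk j < i)%N -> z j = z' j) -> x z = x z') ->
  #|[pred z | a * blk_norm L blk p i (x z)
              < blk_inner L blk p i (sign_vec z) (x z)]|%:R
    <= 2 ^+ d * expR (- (a ^+ 2 * L%:R / 8)) :> R.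
Proof.
move=> a0 xdep.
apply: (@resample_card _ _ [pred j | blk j == i] (fun z z' =>
  a * blk_norm L blk p i (x z) < blk_inner L blk p i (sign_vec z') (x z))).
- move=> z z' y; have -> : x y = x z.
    by apply: xdep => j ji; rewrite ffunE/= ltn_eqF.
  congr (_ < _); rewrite !blk_innerE; congr (_ * _); apply: eq_bigr => j ji.
  by rewrite !mxE ffunE/= ji.
- by move=> z; exact: sign_vec_tail.
Qed.

End random_signs.

(** * The resisting oracle *)

Section finite_family.
Context {R : realType} {d : nat}.
Local Notation E := 'rV[R]_d.
Variables (F : set (E -> R)) (X : set E) (Ans : Type) (K : nat).
Variables (O : (E -> R) -> E -> Ans) (eps : R).

Lemma eps_solution_le f x y : eps_solution X f eps x -> X y -> f x <= f y + eps.
Proof.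
move=> [_ fx] Xy; rewrite addrC -lerBlDr -lee_fin; apply: le_trans fx.
by rewrite EFinB leeB// ereal_inf_lbound//; exists y.
Qed.

Lemma successP (A : algorithm X Ans K) f tau : success F O A eps tau f ->
  exists t k, (t < tau)%N /\ eps_solution X f eps (batch O A f t k).
Proof.
move=> [_ le]; apply: contrapT => none.
(* Batches count from 0, so an index [t >= tau] costs at least [tau + 1] rounds; this covers the
   value +oo too. *)
suff : ((tau.+1%:R)%:E <= num_rounds O A f eps :> \bar R)%E.
  by move=> /le_trans /(_ le); rewrite lee_fin ler_nat ltnn.
apply: le_ereal_inf_tmp => _ [t [k fk] <-]; rewrite lee_fin ler_nat ltnS leqNgt.
by apply/negP => tt; apply: none; exists t, k.
Qed.

Variables (Z : finType) (z0 : Z) (f : Z -> E -> R).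
Hypothesis fF : forall z, F (f z).

Local Notation T := (g_sigma_algebraType [set: set (E -> R)]).

Let family_point k : T := f (nth z0 (enum Z) k).

(** Uniform measure on the indices pushed to the power set of functions, so every event is
    measurable and [f] may repeat values. *)
Definition family_measure : set T -> \bar R :=
  mscale (#|Z|%:R^-1)%:nng (msum (fun k => \d_(family_point k)) #|Z|).

HB.instance Definition _ := Measure.on family_measure.

Lemma family_measureE (A : set (E -> R)) : family_measure A =
  (#|Z|%:R^-1 * #|[pred z | f z \in A]|%:R)%:E.
Proof.
rewrite /family_measure /mscale/= /msum EFinM; congr (_ * _)%E.
have -> : #|[pred z | f z \in A]|%:R = \sum_z (f z \in A)%:R :> R.
  rewrite -sum1_card natr_sum big_mkcond; apply: eq_bigr => z _.
  by rewrite inE; case: ifP.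
have -> : \sum_z (f z \in A)%:R = \sum_(z <- enum Z) (f z \in A)%:R :> R.
  by rewrite big_enum.
rewrite (big_nth z0) big_mkord -sumEFin -cardE.
by apply: eq_bigr => k _; rewrite /= /dirac indicE.
Qed.

Let Z_gt0 : 0 < #|Z|%:R :> R.
Proof. by rewrite ltr0n; apply/card_gt0P; exists z0. Qed.

Lemma family_measureT : family_measure [set: T] = 1%E.
Proof.
have cE : #|[pred z | f z \in [set: T]]| = #|{: Z}|.
  by apply: eq_card => z; rewrite !inE mem_set.
by rewrite family_measureE cE mulVf ?gt_eqF.
Qed.

HB.instance Definition _ :=
  Measure_isProbability.Build _ _ _ family_measure family_measureT.

Lemma family_measurable (A : set (E -> R)) : <<s [set: set (E -> R)] >> A.
Proof. exact: sub_sigma_algebra. Qed.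

Lemma family_supp : family_measure F = 1%E.
Proof.
have cE : #|[pred z | f z \in F]| = #|{: Z}|.
  by apply: eq_card => z; rewrite !inE mem_set.
by rewrite family_measureE cE mulVf ?gt_eqF.
Qed.

Definition family_distribution : Defs.distribution F :=
  @Distribution _ _ F _ family_measure (family_measurable F) family_supp.

(** Success is monotone in the number of rounds, so probability [gamma] requires at least [n + 1] of
    them. *)
Lemma compl_hp_ge (gamma M : R) (n : nat) : M <= n.+1%:R ->
  (forall A : algorithm X Ans K,
    #|[pred z | f z \in success F O A eps n]|%:R < gamma * #|Z|%:R) ->
  (M%:E <= compl_hp F X K O gamma eps)%E.
Proof.
move=> Mn rare; apply: (@le_trans _ _ (n.+1%:R)%:E); first by rewrite lee_fin.
apply: ereal_sup_ge; eexists.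
  by exists family_distribution => //= A tau; exact: family_measurable.
apply: le_ereal_inf_tmp => _ [A _ <-]; apply: le_ereal_inf_tmp => _ [tau tauP <-].
rewrite lee_fin ler_nat ltnNge; apply/negP => taun.
move: tauP; rewrite /= family_measureE lee_fin => le.
have := rare A; rewrite ltNge => /negP; apply.
rewrite -ler_pdivlMr// mulrC; apply: (le_trans le).
rewrite ler_pM2l ?invr_gt0// ler_nat; apply: subset_leq_card.
apply/fintype.subsetP => z; rewrite !inE => -[Fz h]; split=> //.
by apply: le_trans h _; rewrite lee_fin ler_nat.
Qed.

End finite_family.

(** * Ghost runs, answered by a different function in each round *)

Section ghost_transcript.
Context {R : realType} {d : nat}.
Local Notation E := 'rV[R]_d.
Variables (F : set (E -> R)) (X : set E) (Ans : Type) (K : nat).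
Variables (O : (E -> R) -> E -> Ans) (A : algorithm X Ans K).

Fixpoint ghost (g : nat -> E -> R) (t : nat) : history Ans K :=
  if t is t'.+1 then
    let h := ghost g t' in
    let b := next_batch A h in
    rcons h (b, fun k => O (g t') (b k))
  else [::].

Lemma eq_ghost g g' t : (forall t', (t' < t)%N -> g t' = g' t') ->
  ghost g t = ghost g' t.
Proof.
elim: t => //= t IH gg; rewrite IH ?gg// => t' tt.
by apply: gg; rewrite ltnS ltnW.
Qed.

Lemma transcript_ghost (f : E -> R) g t : local_oracle F X O ->
  F f -> (forall t', F (g t')) ->
  (forall t' k, (t' < t)%N ->
     \forall y \near next_batch A (ghost g t') k, f y = g t' y) ->
  transcript O A f t = ghost g t.
Proof.
move=> Oloc Ff Fg; elim: t => //= t IH near_eq.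
rewrite IH; last by move=> t' k tt; apply: near_eq; rewrite ltnS ltnW.
congr (rcons _ (_, _)); apply/funext => k.
by apply: Oloc => //; [exact: next_batch_feasible|exact: near_eq].
Qed.

End ghost_transcript.

Section resistance.
Context {R : realType} {d n : nat} (L : nat) (blk : 'I_d -> nat) (p : R).
Local Notation E := 'rV[R]_d.
Local Notation Z := {ffun 'I_d -> bool}.
Hypotheses (p_ge2 : 2 <= p) (L_gt0 : (0 < L)%N).
Hypothesis card_blk : forall i : 'I_n, #|[pred j | blk j == i]| = L.
Variables (t0 : 'I_n) (eta s delta a kappa Lam eps : R).
Hypotheses (eta_gt0 : 0 < eta) (s_ge1 : 1 <= s).
Hypothesis s_or : s = p / 2 \/ n%:R `^ s^-1 <= 3.
Hypotheses (a01 : 0 < a <= 1 / 16) (gap : 6 * a + eta < delta).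
Hypotheses (kappa01 : 0 <= kappa <= 1) (Lam_ge : s / eta * 6 + 1 <= Lam).
Variables (X : set E) (Ans : Type) (K : nat) (O : (E -> R) -> E -> Ans).
Local Notation F := (smooth_class p kappa 1).
Hypotheses (Oloc : local_oracle F X O) (ballX : lpball p `<=` X).
Hypothesis eps_lt : forall t : 'I_n, eps <
  hoelder_scale kappa Lam * (n%:R `^ (- p^-1) - (3 * a + t%:R * delta + eta)).

Let a0 : 0 < a. Proof. by case/andP: a01. Qed.
Let delta_ge0 : 0 <= delta.
Proof. by apply: ltW; apply: lt_trans gap; rewrite ltr_wpDl// mulr_ge0// ltW. Qed.

Local Notation hardf rho :=
  (fun x => hoelder_scale kappa Lam * hard L blk p t0 delta eta_gt0 s_ge1 rho x).

Local Notation signs z := (@sign_vec R d n L blk p z).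

Definition resisting (z : Z) : E -> R := hardf (signs z).

Let revealed (z : Z) (t : nat) : E -> R :=
  hardf (blk_mask blk t (signs z)).

Let sign_vec_le1 z (i : 'I_n) : blk_norm L blk p i (signs z) <= 1.
Proof. by rewrite blk_norm_sign_vec. Qed.

Lemma resisting_smooth z : F (resisting z).
Proof. exact: hard_smooth_class. Qed.

Let revealed_smooth z t : F (revealed z t).
Proof.
by apply: hard_smooth_class => // i; exact: blk_norm_mask.
Qed.

Variable (A : algorithm X Ans K).

Let query (t : nat) (k : 'I_K) (z : Z) : E :=
  next_batch A (ghost O A (revealed z) t) k.

(** Batch [t] has seen answers only for the masks [0, ..., t - 1], hence the strict inequality. *)
Let query_dep t k (z z' : Z) : (forall j, (blk j < t)%N -> z j = z' j) ->
  query t k z = query t k z'.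
Proof.
move=> zz; suff E : ghost O A (revealed z) t = ghost O A (revealed z') t.
  by rewrite /query E.
apply: eq_ghost => t' tt; rewrite /revealed.
suff -> : blk_mask blk t' (signs z) = blk_mask blk t' (signs z') by [].
apply/rowP => j; rewrite !mxE; case: ifP => // jt.
by rewrite zz// (leq_ltn_trans jt).
Qed.

(* For [i = t] only the lower tail matters and for [i > t] only the upper one. *)
Let tail (t : 'I_n) k (i : 'I_n) z :=
  let x := if i == t then - query t k z else query t k z in
  (t <= i)%N && (a * blk_norm L blk p i x
                 < blk_inner L blk p i (signs z) x).

Let tail_card t k i : #|[pred z | tail t k i z]|%:R
  <= 2 ^+ d * expR (- (a ^+ 2 * L%:R / 8)) :> R.
Proof.
have [ti|ti] := leqP t i; last first.
  rewrite eq_card0 ?mulr_ge0 ?expR_ge0 ?exprn_ge0// => z.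
  by rewrite inE /tail leqNgt ti.
have dep (z z' : Z) : (forall j, (blk j < i)%N -> z j = z' j) ->
    (if i == t then - query t k z else query t k z) =
    (if i == t then - query t k z' else query t k z').
  move=> zz; rewrite (@query_dep t k z z')// => j jt.
  by apply: zz; exact: leq_trans ti.
apply: le_trans (sign_vec_tail_adaptive p L_gt0 a0 dep); rewrite ler_nat; apply: subset_leq_card.
by apply/fintype.subsetP => z; rewrite !inE => /andP[].
Qed.

Let quiet_query z (t : 'I_n) k : (forall i, ~~ tail t k i z) ->
  quiet L blk p a t (signs z) (query t k z).
Proof.
move=> h; split=> [|i ti].
  have := h t; rewrite /tail eqxx leqnn/= -leNgt /blk_norm.
  have -> : blk_inner L blk p t (- query t k z) (- query t k z) =
      blk_inner L blk p t (query t k z) (query t k z).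
    by rewrite !blk_innerE; congr (_ * _); apply: eq_bigr => j _; rewrite !mxE mulrNN.
  have -> : blk_inner L blk p t (signs z) (- query t k z) =
      - blk_inner L blk p t (signs z) (query t k z).
    exact: linearN.
  by rewrite lerNl.
have := h i; rewrite /tail (ltnW ti)/= -leNgt.
by rewrite -val_eqE/= gtn_eqF.
Qed.

(** Union bound over round, query and block. Without a tail event the true run is the ghost run, all
    its queries are quiet, and quiet values are too large. *)
Lemma resisting_success_card :
  #|[pred z | resisting z \in success F O A eps n]|%:R
  <= (n * K * n)%:R * (2 ^+ d * expR (- (a ^+ 2 * L%:R / 8))) :> R.
Proof.
pose bad (w : 'I_n * 'I_K * 'I_n) := [pred z | tail w.1.1 w.1.2 w.2 z].
have sub : forall z, resisting z \in success F O A eps n ->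
    exists w, z \in bad w.
  move=> z; rewrite inE => /successP[t [k [tn sol]]].
  apply: contrapT => good.
  have notail (t' : 'I_n) k' i : ~~ tail t' k' i z.
    by apply/negP => h; apply: good; exists (t', k', i); rewrite inE.
  have tE : transcript O A (resisting z) t = ghost O A (revealed z) t.
    apply: (transcript_ghost Oloc) => // [|t' k' tt]; first exact: resisting_smooth.
    have tn' := ltn_trans tt tn.
    have q : quiet L blk p a (Ordinal tn') (signs z) (query t' k' z).
      exact: quiet_query.
    have a01' : 0 <= a <= 1 / 16 by case/andP: a01 => /ltW -> ->.
    have := hard_near_mask p_ge2 L_gt0 card_blk t0 eta_gt0 s_ge1 delta_ge0
      (sign_vec_le1 z) a01' gap q.
    by apply: filterS => y /= ye; rewrite /resisting /revealed/= ye.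
  have q : quiet L blk p a (Ordinal tn) (signs z) (query t k z).
    exact: quiet_query.
  have ge := hard_quiet_ge t0 eta_gt0 s_ge1 delta_ge0 (ltW a0) q.
  have lt := eps_lt (Ordinal tn); set c := n%:R `^ (- p^-1) in lt.
  have n1 : 1 <= n%:R :> R by rewrite ler1n (leq_ltn_trans _ tn).
  have c01 : 0 <= c <= 1.
    rewrite powR_ge0/= -[leRHS](powRr0 n%:R) ler_powR// oppr_le0 invr_ge0.
    by rewrite (le_trans _ p_ge2).
  have le := hard_opp_le t0 eta_gt0 s_ge1 delta_ge0 c01
    (fun i => blk_inner_sign_vec p L_gt0 card_blk i z).
  (* This feasible point witnesses a small infimum. *)
  have Xy : X (- c *: signs z).
    by apply: ballX; exact: lpnorm_sign_vec_le.
  have := eps_solution_le sol Xy.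
  rewrite /batch tE -/(query t k z) /resisting /=.
  have th0 : 0 < hoelder_scale kappa Lam.
    apply: hoelder_scale_gt0; apply: lt_le_trans Lam_ge.
    by rewrite ltr_wpDl// mulr_ge0// divr_ge0 ?ltW// (lt_le_trans _ s_ge1).
  have le2 := ler_wpM2l (ltW th0) le; have ge2 := ler_wpM2l (ltW th0) ge.
  move: lt le2 ge2; rewrite /= mulrBr mulrN mulrN.
  move: (_ * hard _ _ _ _ _ _ _ _ _) (_ * hard _ _ _ _ _ _ _ _ _) => u v.
  by move: (_ * c) (_ * (_ + eta)) => w y; lra.
apply: (@le_trans _ _ (\sum_w #|bad w|%:R)); last first.
  apply: (@le_trans _ _ (\sum_(w : 'I_n * 'I_K * 'I_n)
      2 ^+ d * expR (- (a ^+ 2 * L%:R / 8)))).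
    by apply: ler_sum => w _; exact: tail_card.
  by rewrite sumr_const !card_prod !card_ord mulr_natl.
have cardE (Q : pred Z) : #|[pred z | Q z]|%:R = \sum_z (Q z)%:R :> R.
  rewrite -sum1_card natr_sum big_mkcond; apply: eq_bigr => z _.
  by rewrite inE; case: ifP.
rewrite cardE (eq_bigr (fun w => \sum_z (bad w z)%:R)) => [|w _]; last first.
  by rewrite -cardE.
rewrite exchange_big/= ler_sum// => z _.
have [/sub[w zw]|_] := boolP (_ \in _); last by rewrite sumr_ge0.
by rewrite inE/= in zw; rewrite (bigD1 w)//= zw lerDl sumr_ge0.
Qed.

End resistance.

(** * Small values of [M], by linear functions *)

Section linear_functions.
Context {R : realType} {d : nat}.
Local Notation E := 'rV[R]_d.

Lemma linear_smooth_class (p kappa : R) (g : E) : 1 < p -> 0 <= kappa <= 1 ->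
  (forall h, inner g h <= lpnorm p h) ->
  smooth_class p kappa 1 (fun x => 2^-1 * inner g x).
Proof.
move=> p1 k01 gh.
(* The choice [Lam = 2] makes the scale 1/2 for every [kappa]. *)
have := @hoelder_scale_smooth_class R d p kappa 2 (inner g) (fun=> g) p1 k01.
rewrite /hoelder_scale divff ?gt_eqF// powR1 mulr1; apply => //.
- by move=> x y; rewrite linearB/= addrC subrK.
- move=> x y h; rewrite subrr /inner big1 ?mulr_ge0 ?lpnorm_ge0// => i _.
  by rewrite mxE mul0r.
Qed.

Lemma lpnorm_delta (p : R) (j : 'I_d) : 0 < p -> lpnorm p (delta_mx 0 j : E) = 1.
Proof.
move=> p0; rewrite /lpnorm (bigD1 j)//= mxE !eqxx normr1 powR1 big1 ?addr0 ?powR1//.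
by move=> i /negPf ij; rewrite mxE ij andbF normr0 powR0// gt_eqF.
Qed.

Lemma norm_coord_le (p : R) (x : E) j : 0 < p -> `|x 0 j| <= lpnorm p x.
Proof.
move=> p0; have -> : `|x 0 j| = (`|x 0 j| `^ p) `^ p^-1.
  by rewrite -powRrM mulfV ?gt_eqF// powRr1.
rewrite powR_le ?invr_ge0 ?(ltW p0) ?powR_ge0// (bigD1 j)//= lerDl.
by rewrite sumr_ge0// => i _; exact: powR_ge0.
Qed.

Variables (p kappa : R) (K : nat) (X : set E) (eps gamma M : R).
Variables (Ans : Type) (O : (E -> R) -> E -> Ans).
Hypotheses (p_gt1 : 1 < p) (kappa01 : 0 <= kappa <= 1) (gamma_gt0 : 0 < gamma).
Local Notation F := (smooth_class p kappa 1).

(** Nothing is queried in 0 rounds, so a one-element family suffices. *)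
Lemma compl_hp_ge1 : M <= 1 -> (M%:E <= compl_hp F X K O gamma eps)%E.
Proof.
move=> M1; apply: (@compl_hp_ge _ _ F X Ans K O eps unit tt
  (fun=> (fun x => 2^-1 * inner (0 : E) x)) _ _ _ 0) => //.
  move=> _; apply: linear_smooth_class => // h; rewrite /inner big1 ?lpnorm_ge0//.
  by move=> i _; rewrite mxE mul0r.
move=> A; rewrite eq_card0 ?mulr_gt0 ?ltr0n ?card_unit// => z.
by rewrite inE; apply/negbTE; rewrite notin_setE => /successP[t [k []]].
Qed.

(* With one query per round, the first query cannot be good for both of two
   opposite linear functions. *)
Lemma compl_hp_ge2 : (0 < d)%N -> K = 1%N -> M <= 2 -> 1 / 2 < gamma ->
  eps < 1 / 2 -> lpball p `<=` X -> (M%:E <= compl_hp F X K O gamma eps)%E.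
Proof.
move=> d0 K1 M2 gamma2 eps2 ballX; have p0 : 0 < p by exact: lt_trans p_gt1.
pose e : E := delta_mx 0 (Ordinal d0).
pose g (b : bool) : E := (-1) ^+ b *: e.
have ge b h : inner (g b) h = (-1) ^+ b * h 0 (Ordinal d0).
  rewrite innerZl; congr (_ * _); rewrite /inner (bigD1 (Ordinal d0))//= mxE !eqxx.
  rewrite mul1r big1 ?addr0// => i /negPf id; by rewrite mxE id andbF mul0r.
have gX b : X (g b).
  apply: ballX; rewrite /lpball/= /g -signr_odd; case: (odd b); rewrite /=.
    by rewrite expr1 scaleN1r lpnormN lpnorm_delta.
  by rewrite expr0 scale1r lpnorm_delta.
apply: (@compl_hp_ge _ _ F X Ans K O eps bool true
  (fun b => (fun x => 2^-1 * inner (g b) x)) _ _ _ 1) => //.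
  move=> b; apply: linear_smooth_class => // h; rewrite ge.
  apply: le_trans (norm_coord_le h (Ordinal d0) p0).
  by rewrite (le_trans (ler_norm _))// normrM normrX normrN1 expr1n mul1r.
move=> A; rewrite card_bool.
apply: (@le_lt_trans _ _ 1); last by lra.
rewrite lern1 leqNgt; apply/negP => /card_gt1P[b [b' []]].
rewrite !inE => sb sb' bb'.
have [t [k [t1 solb]]] := successP sb; have [t' [k' [t1' solb']]] := successP sb'.
have ord0K (i : 'I_K) : i = 0%N :> nat.
  by apply/eqP; rewrite -leqn0 -ltnS (leq_trans (ltn_ord i))// K1.
have kk : k' = k by apply/val_inj; rewrite /= !ord0K.
move: t t' t1 t1' solb solb' => [|//] [|//] _ _; rewrite kk /batch /=.
move: (next_batch A [::] k) => x solb solb'.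
have := eps_solution_le solb (gX (~~ b)); have := eps_solution_le solb' (gX (~~ b')).
rewrite !ge !mxE !eqxx/=; move: bb'; case: b {sb solb}; case: b' {sb' solb'} => // _.
  by rewrite !expr0 !expr1; lra.
by rewrite !expr0 !expr1; lra.
Qed.

End linear_functions.

(** * Parameters *)

Lemma card_divn_block (d n : nat) (i : 'I_n) : (0 < d %/ n)%N ->
  #|[pred j : 'I_d | (j %/ (d %/ n))%N == i]| = (d %/ n)%N.
Proof.
set L := (d %/ n)%N => L0.
have lt (l : 'I_L) : (i * L + l < d)%N.
  apply: (@leq_trans (n * L)%N); last by rewrite mulnC leq_trunc_div.
  by rewrite (leq_trans _ (leq_mul (ltn_ord i) (leqnn L)))// mulSn addnC ltn_add2r.
pose f l := Ordinal (lt l).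
have f_inj : injective f by move=> l l' [] /addnI /val_inj.
rewrite -[RHS](card_ord L) -(card_codom f_inj); apply: eq_card => j; rewrite inE.
apply/eqP/codomP => [ji|[l ->]]; last by rewrite /= divnMDl// divn_small ?addn0.
by exists (Ordinal (ltn_pmod j L0)); apply/val_inj; rewrite /= -ji -divn_eq.
Qed.

Section numeric_facts.
Context {R : realType}.

Lemma ln2_ge : 1 / 2 <= ln 2 :> R.
Proof.
rewrite -ler_expR lnK ?posrE// -[1 / 2]opprK expRN invf_ple ?posrE ?expR_gt0//.
by apply: le_trans (expR_ge1Dx _); lra.
Qed.

(** The left side is [exp (2 ln n / ln d)]; since [n ^ 3 <= d] the exponent is at most 2/3. *)
Lemma powR_ln_le3 (n d : nat) : (1 < n)%N -> (n ^ 3 <= d)%N ->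
  n%:R `^ (ln d%:R / 2)^-1 <= 3 :> R.
Proof.
move=> n1 nd; have n0 : 0 < n%:R :> R by rewrite ltr0n ltnW.
have d0 : 0 < d%:R :> R by rewrite ltr0n (leq_trans _ nd)// expn_gt0 ltnW.
have ln_n : 0 < ln n%:R :> R by rewrite ln_gt0// ltr1n.
have ln_nd : 3 * ln n%:R <= ln d%:R :> R.
  rewrite -[3]/(3%:R) mulr_natl -lnXn// ler_ln ?posrE ?exprn_gt0//.
  by rewrite -natrX ler_nat.
have ln_d : 0 < ln d%:R :> R by apply: lt_le_trans ln_nd; rewrite mulr_gt0.
rewrite /powR gt_eqF//; apply: (@le_trans _ _ (expR (2 / 3))).
  rewrite ler_expR (_ : _ * _ = 2 * ln n%:R / ln d%:R); last first.
    by field; rewrite gt_eqF.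
  by rewrite ler_pdivrMr// mulrAC ler_pdivlMr//; lra.
rewrite -[2 / 3]opprK expRN invf_ple ?posrE ?expR_gt0//.
by apply: le_trans (expR_ge1Dx _); lra.
Qed.

(* The two terms of the minimum are [sigma `^ (- p)] and
   [d * sigma `^ (2 (1 + p)) / (2 ^ 13 ln (M K / gamma))]. *)
Lemma min_terms (p kappa m eps M l d sigma : R) :
  2 <= p -> 0 <= kappa <= 1 -> 0 < eps -> 1 < M -> 0 < l -> 0 <= d ->
  sigma = (2 `^ (3 + 4 * kappa) * eps * m `^ kappa) `^ (1 + kappa * (1 + p))^-1 ->
  M <= (1 / (2 `^ (3 + 4 * kappa) * eps * m `^ kappa))
         `^ (p / (1 + kappa * (1 + p))) ->
  M <= d / (2 ^+ 9 * l) *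
    (2 `^ ((1 + 3 * p + 2 * kappa * (1 + p)) / (1 + p)) * m `^ kappa * eps)
       `^ (2 * (1 + p) / (1 + kappa * (1 + p))) ->
  [/\ 0 < sigma < 1, 0 < m `^ kappa, M * sigma `^ p <= 1,
      2 `^ (3 + 4 * kappa) * eps * m `^ kappa = sigma `^ (1 + kappa * (1 + p))
    & 128 * (64 * (M * l)) <= d * (sigma `^ (1 + p)) ^+ 2].
Proof.
move=> p2 /andP[k0 k1] eps0 M1 l0 d0 sE.
set e := 1 + kappa * (1 + p); set S := 2 `^ (3 + 4 * kappa) * eps * m `^ kappa.
rewrite -/S -/e in sE *.
have p0 : 0 < p by lra.
have p1 : 0 < 1 + p by lra.
have e0 : 0 < e by rewrite ltr_pwDl// mulr_ge0// ltW.
have S_ge0 : 0 <= S by rewrite !mulr_ge0 ?powR_ge0// ltW.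
move=> MA MB.
(* If [S] were 0, as for [ln d = 0] and [kappa > 0], then [1 / 0 = 0] would make the first term 0,
   against [1 < M]. *)
have S0 : 0 < S.
  rewrite lt_neqAle S_ge0 andbT; apply/negP => /eqP SE.
  move: MA; rewrite -SE invr0 mulr0 powR0 ?mulf_neq0 ?invr_eq0 ?gt_eqF//.
  by lra.
have m0 : 0 < m `^ kappa.
  rewrite lt_neqAle powR_ge0 andbT; apply/negP => /eqP mE.
  by move: S0; rewrite /S -mE mulr0 ltxx.
have sig0 : 0 < sigma by rewrite sE powR_gt0.
have SE : S = sigma `^ e by rewrite sE -powRrM mulVf ?gt_eqF// powRr1.
have Msig : M * sigma `^ p <= 1.
  move: MA; rewrite powR_div// powR1 div1r SE -powRrM mulrCA divff ?gt_eqF// mulr1.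
  by rewrite -div1r ler_pdivlMr// powR_gt0.
have sig1 : sigma < 1.
  rewrite ltNge; apply/negP => s1.
  have : 1 <= sigma `^ p by rewrite -(powRr0 sigma) ler_powR// ltW.
  by move: Msig; move: (sigma `^ p) => u; nra.
split=> //; first by rewrite sig0.
move: MB; set Y := 2 `^ _ * _ * eps.
have YE : Y = S * 2 `^ (- (2 * e / (1 + p))).
  rewrite /Y /S; have -> : (1 + 3 * p + 2 * kappa * (1 + p)) / (1 + p) =
      3 + 4 * kappa - 2 * e / (1 + p) by rewrite /e; field; rewrite gt_eqF.
  by rewrite powRB ?pnatr_eq0 ?implybT// powRN; ring.
have -> : Y `^ (2 * (1 + p) / e) = (sigma `^ (1 + p)) ^+ 2 / 16.
  rewrite YE powRM ?powR_ge0// SE -!powRrM.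
  have -> : e * (2 * (1 + p) / e) = (1 + p) * 2 by field; rewrite gt_eqF.
  have -> : - (2 * e / (1 + p)) * (2 * (1 + p) / e) = - 4%:R.
    by field; rewrite !gt_eqF.
  by rewrite powR_invn// powRrM powR_mulrn ?powR_ge0//; congr (_ * _^-1); ring.
move: (sigma `^ (1 + p)) => w.
have -> : d / (2 ^+ 9 * l) * (w ^+ 2 / 16) = (d * w ^+ 2) / (128 * (64 * l)).
  by field; rewrite gt_eqF.
by rewrite ler_pdivlMr ?mulr_gt0// mulrCA (mulrCA M).
Qed.

End numeric_facts.

(** * The choice of parameters when [min(p, ln d)] is at least 2 *)

Section large_dimension.
Context {R : realType} {d : nat}.
Local Notation E := 'rV[R]_d.
Variables (p kappa : R) (K : nat) (X : set E) (eps gamma M m sigma : R).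
Variables (Ans : Type) (O : (E -> R) -> E -> Ans).
Local Notation F := (smooth_class p kappa 1).
Local Notation l := (ln (M * K%:R / gamma)).
Local Notation omega := (sigma `^ (1 + p)).
Hypotheses (p_ge2 : 2 <= p) (kappa01 : 0 <= kappa <= 1).
Hypotheses (d_gt0 : (1 <= d)%N) (K_gt0 : (1 <= K)%N).
Hypotheses (gamma_gt0 : 0 < gamma) (gamma_lt1 : gamma < 1) (M_gt1 : 1 < M).
Hypotheses (sigma01 : 0 < sigma < 1) (M_sigma : M * sigma `^ p <= 1).
Hypothesis budget : 128 * (64 * (M * l)) <= d%:R * omega ^+ 2.

Let p_gt0 : 0 < p. Proof. exact: lt_le_trans p_ge2. Qed.
Let sigma_gt0 : 0 < sigma. Proof. by case/andP: sigma01. Qed.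
Let M_gt0 : 0 < M. Proof. exact: lt_trans M_gt1. Qed.
Let K_ge1 : 1 <= K%:R :> R. Proof. by rewrite ler1n. Qed.
Let omega_gt0 : 0 < omega. Proof. exact: powR_gt0. Qed.

Let M_omega : M * omega <= sigma.
Proof.
rewrite powRD ?(gt_eqF sigma_gt0) ?implybT// powRr1 ?(ltW sigma_gt0)//.
by rewrite mulrCA ler_piMr// ltW.
Qed.

Let omega_lt1 : omega < 1.
Proof.
case/andP: sigma01 => _; apply: le_lt_trans; apply: le_trans M_omega.
by rewrite ler_peMl ?ltW.
Qed.

Let M_le_ratio : M <= M * K%:R / gamma.
Proof.
rewrite -mulrA ler_peMr ?(ltW M_gt0)// ler_pdivlMr// mul1r.
by apply: le_trans K_ge1; exact: ltW.
Qed.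

Lemma log_ratio_gt0 : 0 < l.
Proof. by rewrite ln_gt0// (lt_le_trans M_gt1). Qed.

Let l_gt0 := log_ratio_gt0.

Lemma log_ratio_ge : 2 <= M * K%:R / gamma -> 1 / 2 <= l.
Proof.
move=> h; apply: (le_trans ln2_ge); rewrite ler_ln ?posrE//.
exact: lt_le_trans h.
Qed.

(* Since [M * omega <= 1]. *)
Let M_cube_le : 1 / 2 <= l -> 128 * (32 * M ^+ 3) <= d%:R.
Proof.
move=> l2; have Mo1 : (M * omega) ^+ 2 <= 1.
  rewrite expr_le1// ?mulr_ge0 ?(ltW M_gt0) ?(ltW omega_gt0)//.
  by apply: (le_trans M_omega); case/andP: sigma01 => _ /ltW.
have h1 : d%:R * (M * omega) ^+ 2 <= d%:R by rewrite ler_piMr.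
apply: le_trans h1; have := ler_wpM2l (sqr_ge0 M) budget.
have -> : M ^+ 2 * (d%:R * omega ^+ 2) = d%:R * (M * omega) ^+ 2 by ring.
apply: le_trans; have M3 : 0 <= M ^+ 3 by rewrite exprn_ge0// ltW.
have -> : M ^+ 2 * (128 * (64 * (M * l))) = 128 * (32 * (M ^+ 3 * (2 * l))) by ring.
by rewrite !ler_pM2l// ler_peMr//; lra.
Qed.

Lemma log_dim_ge : 1 / 2 <= l -> 2 <= ln d%:R :> R.
Proof.
move=> /M_cube_le d_ge; have d128 : 2 ^+ 4 <= d%:R :> R.
  apply: le_trans d_ge; have M3 : 1 <= M ^+ 3 by rewrite exprn_ege1// ltW.
  by lra.
apply: (@le_trans _ _ (ln (2 ^+ 4 : R))).
  by rewrite lnXn// -[_ *+ 4]mulr_natl; have := @ln2_ge R; lra.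
by rewrite ler_ln ?posrE// ?exprn_gt0// ltr0n.
Qed.

Hypotheses (mE : m = Num.min p (ln d%:R)) (m_ge2 : 2 <= m).
Hypothesis epsE : 2 `^ (3 + 4 * kappa) * eps * m `^ kappa
  = sigma `^ (1 + kappa * (1 + p)).
Hypotheses (Oloc : local_oracle F X O) (ballX : lpball p `<=` X).

Let m_gt0 : 0 < m. Proof. exact: lt_le_trans m_ge2. Qed.

(** So [eps] is [sigma / 4] times the Hoelder scale for [Lam = 32 * m / omega]. *)
Let eps_eq : eps = 1 / 8 * sigma * (omega / (16 * m)) `^ kappa.
Proof.
have c2 : 2 `^ (3 + 4 * kappa) = 8 * 16 `^ kappa :> R.
  have -> : 8 = 2 `^ 3 :> R by rewrite powR_mulrn//; ring.
  have -> : 16 = 2 `^ 4 :> R by rewrite powR_mulrn//; ring.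
  by rewrite -powRrM powRD ?pnatr_eq0 ?implybT.
have k16 : 0 < 16 `^ kappa :> R by rewrite powR_gt0.
have km : 0 < m `^ kappa by rewrite powR_gt0.
move: epsE; rewrite c2 => e.
have -> : eps = 8 * 16 `^ kappa * eps * m `^ kappa / (8 * 16 `^ kappa * m `^ kappa).
  by field; rewrite !gt_eqF.
rewrite e powRD ?(gt_eqF sigma_gt0) ?implybT// (powRr1 (ltW sigma_gt0)).
rewrite powR_div ?(ltW omega_gt0) ?mulr_ge0 ?(ltW m_gt0)//.
rewrite powRM ?(ltW m_gt0)// [kappa * _]mulrC powRrM.
by field; rewrite !gt_eqF.
Qed.

Lemma compl_hp_ge_large : (M%:E <= compl_hp F X K O gamma eps)%E.
Proof.
have om0 := omega_gt0; have om1 := omega_lt1; have m2 := m_ge2.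
(* The largest integer strictly below [M]: few enough rounds to defeat, and one more reaches [M]. *)
have [n [n0 nM Mn]] : exists n, [/\ (0 < n)%N, n%:R < M & M <= n.+1%:R].
  have ex : exists n, M <= n.+1%:R.
    exists (Num.bound M); apply: ltW; apply: (lt_trans (archi_boundP (ltW M_gt0))).
    by rewrite ltr_nat.
  case: (ex_minnP ex) => n Mn minn.
  have n0 : (0 < n)%N.
    by case: n Mn {minn} => // Mn; move: M_gt1; rewrite ltNge Mn.
  exists n; split=> //; rewrite ltNge; apply/negP => Mn'.
  by have := minn n.-1; rewrite prednK// => /(_ Mn'); case: (n) n0 => // k _; rewrite ltnn.
have n0R : 0 < n%:R :> R by rewrite ltr0n.
have n_cube : (1 < n)%N -> (n ^ 3 <= d)%N.
  move=> n1; have l2 : 1 / 2 <= l.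
    apply: log_ratio_ge; apply: le_trans M_le_ratio; apply: ltW.
    by apply: le_lt_trans nM; rewrite ler_nat.
  rewrite -(ler_nat R) natrX; apply: le_trans (M_cube_le l2).
  have : n%:R ^+ 3 <= M ^+ 3 by rewrite lerXn2r ?nnegrE ?(ltW n0R) ?(ltW M_gt0)// ltW.
  have : 0 <= M ^+ 3 by rewrite exprn_ge0// ltW.
  by move: (M ^+ 3) (n%:R ^+ 3) => u v; lra.
have nd : (n <= d)%N.
  move: n0; rewrite leq_eqVlt => /predU1P[<-//|n1].
  by rewrite (leq_trans _ (n_cube n1))// -[leqLHS]expn1 leq_exp2l.
pose L := (d %/ n)%N.
have L0 : (0 < L)%N by rewrite divn_gt0.
have dL : d%:R <= 2 * (n%:R * L%:R) :> R.
  rewrite -!natrM ler_nat; apply: ltnW; apply: (leq_trans (ltn_ceil d n0)).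
  by rewrite mulnC mulnCA leq_mul2l mul2n -addnn -addn1 leq_add2l L0 orbT.
pose blk (j : 'I_d) := (j %/ L)%N.
have cardb (i : 'I_n) : #|[pred j | blk j == i]| = L by exact: card_divn_block.
(* In units of [omega / 16], [gap] reads 6 + 2 < 9, and [2 / Lam] becomes [omega / (16 * m)], as
   [eps_eq] requires. *)
pose a := omega / 16; pose eta := omega / 8; pose delta := 9 / 16 * omega.
pose s := m / 2; pose Lam := 32 * m / omega.
have eta_gt0 : 0 < eta by rewrite divr_gt0.
have s_ge1 : 1 <= s by rewrite ler_pdivlMr// mul1r.
have s_or : s = p / 2 \/ n%:R `^ s^-1 <= 3.
  have [mp|md] := leP p (ln d%:R); first by left; rewrite /s mE (min_idPl mp).
  right; move: n0; rewrite leq_eqVlt => /predU1P[<-|n1].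
    by rewrite powR1 ler1n.
  by rewrite /s mE (min_idPr (ltW md)) powR_ln_le3// n_cube.
have a01 : 0 < a <= 1 / 16 by rewrite /a; lra.
have gap : 6 * a + eta < delta by rewrite /a /eta /delta; lra.
have Lam_ge : s / eta * 6 + 1 <= Lam.
  have -> : s / eta * 6 + 1 = (24 * m + omega) / omega.
    by rewrite /s /eta; field; rewrite gt_eqF.
  by rewrite ler_pM2r ?invr_gt0//; lra.
have n_omega : n%:R * omega <= sigma.
  by apply: le_trans M_omega; rewrite ler_pM2r// ltW.
have sigma_c : sigma <= n%:R `^ (- p^-1).
  have -> : n%:R `^ (- p^-1) = (n%:R^-1) `^ p^-1 :> R.
    by rewrite -[n%:R^-1]div1r powR_div// powR1 div1r powRN.
  have -> : sigma = (sigma `^ p) `^ p^-1.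
    by rewrite -powRrM mulfV ?gt_eqF// powRr1// ltW.
  apply: powR_le; rewrite ?invr_ge0 ?(ltW p_gt0) ?powR_ge0//.
  rewrite -[leRHS]div1r ler_pdivlMr// mulrC; apply: le_trans M_sigma.
  by rewrite ler_pM2r ?powR_gt0// ltW.
have eps_lt (t : 'I_n) : eps < hoelder_scale kappa Lam *
    (n%:R `^ (- p^-1) - (3 * a + t%:R * delta + eta)).
  have k0 : 0 < (omega / (16 * m)) `^ kappa 
    by apply: powR_gt0; rewrite divr_gt0 ?mulr_gt0.
  have -> : hoelder_scale kappa Lam = 2^-1 * (omega / (16 * m)) `^ kappa.
    rewrite /hoelder_scale; congr (_ * _ `^ _); rewrite /Lam.
    by field; rewrite !gt_eqF.
  (* The loss [(5 + 9 t) omega / 16] is then at most [9 sigma / 16], so more than [sigma / 4]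
     remains. *)
  have tn : (t%:R + 1) * omega <= sigma.
    by apply: le_trans n_omega; rewrite ler_pM2r// natr1 ler_nat.
  rewrite eps_eq [ltLHS]mulrC [ltRHS]mulrAC [ltRHS]mulrC ltr_pM2l//.
  move: tn sigma_c sigma_gt0 omega_gt0; rewrite /a /eta /delta.
  by move: (n%:R `^ _) => c; lra.
pose f := resisting L blk p (Ordinal n0) delta kappa Lam eta_gt0 s_ge1.
apply: (@compl_hp_ge _ _ F X Ans K O eps _ [ffun=> true] f _ _ _ n) => //.
  by move=> z; apply: resisting_smooth.
move=> A.
have := resisting_success_card p_ge2 L0 cardb (Ordinal n0) eta_gt0 s_ge1 s_or a01
  gap kappa01 Lam_ge Oloc ballX eps_lt A.
move=> /le_lt_trans; apply.
rewrite card_ffun card_bool card_ord natrX mulrCA mulrC ltr_pM2r ?exprn_gt0//.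
(* Each tail thus has probability at most [(M K / gamma) ^ (- 2)], and [n * K * n] of them stay
   below [gamma] because [n < M] and [gamma < 1]. *)
have E_ge : 2 * l <= a ^+ 2 * L%:R / 8.
  have Ln : 128 * (64 * (M * l)) <= 2 * (n%:R * L%:R) * omega ^+ 2.
    by apply: le_trans budget _; rewrite ler_wpM2r ?sqr_ge0.
  have nl : n%:R * l <= M * l by rewrite ler_pM2r// ltW.
  rewrite -(ler_pM2l n0R).
  have -> : n%:R * (a ^+ 2 * L%:R / 8) = (2 * (n%:R * L%:R) * omega ^+ 2) / (128 * 32).
    by rewrite /a; field.
  by rewrite ler_pdivlMr//; move: Ln nl; move: (_ * omega ^+ 2) (M * l) => u v; lra.
have ratio_gt0 : 0 < M * K%:R / gamma by exact: lt_le_trans M_le_ratio.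
apply: (@le_lt_trans _ _ ((n * K * n)%:R * ((M * K%:R / gamma)^-1) ^+ 2)).
  rewrite ler_wpM2l//; apply: (@le_trans _ _ (expR (- (2 * l)))).
    by rewrite ler_expR lerN2.
  by rewrite -mulrN expRM_natl expRN lnK ?posrE.
rewrite !natrM; have K0 : 0 < K%:R :> R by exact: lt_le_trans K_ge1.
have -> : n%:R * K%:R * n%:R * (M * K%:R / gamma)^-1 ^+ 2 =
    gamma * ((n%:R / M) ^+ 2 * (gamma / K%:R)) by field; rewrite !gt_eqF.
rewrite -[ltRHS]mulr1 ltr_pM2l//.
have g1 : gamma / K%:R < 1.
  by rewrite ltr_pdivrMr// mul1r (lt_le_trans gamma_lt1).
have nM1 : (n%:R / M) ^+ 2 <= 1.
  rewrite expr_le1// ?divr_ge0 ?(ltW M_gt0) ?(ltW n0R)//.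
  by rewrite ler_pdivrMr// mul1r ltW.
apply: le_lt_trans g1; rewrite ler_piMl// divr_ge0// ?(ltW gamma_gt0)//.
Qed.

End large_dimension.

Theorem theorem3p8 (R : realType) (q : {poly R}) (p kappa : R) (d K : nat)
    (X : set 'rV[R]_d) (eps gamma : R)
    (Ans : Type) (O : ('rV[R]_d -> R) -> 'rV[R]_d -> Ans) (M : R) :
  2 <= p -> 0 <= kappa <= 1 ->
  (1 <= d)%N -> (1 <= K)%N ->
  closed X -> convex_set X -> lpball p `<=` X ->
  0 < eps < 1 / 2 ->
  0 < q.[d%:R] -> 1 / q.[d%:R] < gamma < 1 ->
  local_oracle (smooth_class p kappa 1) X O ->
  M = Num.min
    ((1 / (2 `^ (3 + 4 * kappa) * eps * Num.min p (ln d%:R) `^ kappa))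
       `^ (p / (1 + kappa * (1 + p))))
    (d%:R / (2 ^+ 9 * ln (M * K%:R / gamma)) *
     (2 `^ ((1 + 3 * p + 2 * kappa * (1 + p)) / (1 + p)) *
        Num.min p (ln d%:R) `^ kappa * eps)
       `^ (2 * (1 + p) / (1 + kappa * (1 + p)))) ->
  (M%:E <= compl_hp (smooth_class p kappa 1) X K O gamma eps)%E.
Proof.
move=> p2 k01 d1 K1 _ _ ballX /andP[eps0 eps2] q0 /andP[gq gamma1] Oloc ME.
have p1 : 1 < p by apply: lt_le_trans p2; rewrite ltr1n.
have gamma0 : 0 < gamma by apply: lt_trans gq; rewrite divr_gt0.
have [M1|M1] := leP M 1; first exact: compl_hp_ge1.
have l0 := log_ratio_gt0 K1 gamma0 gamma1 M1.
move: ME; set m := Num.min p _ => ME.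
have MA : M <= (1 / (2 `^ (3 + 4 * kappa) * eps * m `^ kappa))
    `^ (p / (1 + kappa * (1 + p))) by rewrite {1}ME ge_min lexx.
have MB : M <= d%:R / (2 ^+ 9 * ln (M * K%:R / gamma)) *
    (2 `^ ((1 + 3 * p + 2 * kappa * (1 + p)) / (1 + p)) * m `^ kappa * eps)
      `^ (2 * (1 + p) / (1 + kappa * (1 + p))) by rewrite {1}ME ge_min lexx orbT.
have [sigma01 _ Msigma epsE budget] :=
  min_terms p2 k01 eps0 M1 l0 (ler0n _ d) erefl MA MB.
(* The soft maximum needs [s = m / 2 >= 1]. If [m < 2] then [ln d < 2], which forces
   [M K < 2 gamma], hence [K = 1], [M < 2] and [gamma > 1 / 2]. *)
have [m2|m2] := leP 2 m.
  exact: (compl_hp_ge_large p2 k01 d1 K1 gamma0 gamma1 M1 sigma01 Msigma budget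
    erefl m2 epsE Oloc ballX).
have ratio2 : M * K%:R / gamma < 2.
  rewrite ltNge; apply/negP => h; move: m2; rewrite ltNge /m le_min p2/= => /negP.
  apply; apply: (log_dim_ge d1 M1 sigma01 Msigma budget).
  exact: log_ratio_ge.
move: ratio2; rewrite ltr_pdivrMr// => MK.
have Kone : K = 1%N.
  apply/eqP; rewrite eqn_leq K1 andbT leqNgt; apply/negP => K2.
  have : 2 <= K%:R :> R by rewrite ler_nat.
  by nra.
apply: compl_hp_ge2 => //; move: MK; rewrite Kone mulr1; lra.
Qed.
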